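(* Let $\alpha\in(0,1)$ be irrational, let $(\Omega_\alpha,S)$ be the Sturmian subshift generated by $\alpha$, let $\mu$ be its unique $S$-invariant probability measure, and let $\zeta=\{[0],[1]\}$. (1) The following are equivalent: (a) the partial quotients (coefficients of the continued fraction expansion) of $\alpha$ are bounded; (b) $\underline{\mathcal{R}}_{\zeta}(x)>0$ for $\mu$-almost every $x$; (c) $\overline{\mathcal{R}}_{\zeta}(x)<\infty$ for $\mu$-almost every $x$. (2) If the partial quotients of $\alpha$ are bounded, then $\underline{\mathcal{R}}_{\zeta}(x)<1$ and $\overline{\mathcal{R}}_{\zeta}(x)>1$ for $\mu$-almost every $x$. (3) Statements (1) and (2) also hold for the rotation $R_\alpha:[0,1)\to[0,1)$, $R_\alpha(t)=t+\alpha \bmod 1$, with Lebesgue measure in place of $\mu$ and with the partition $\zeta=\{[0,1-\alpha),[1-\alpha,1)\}$.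
   Context: Define $R_\alpha(t)=t+\alpha \pmod 1$ on $[0,1)$ and $I_\alpha:[0,1)\to\{0,1\}$ by $I_\alpha(t)=0$ if $t\in[0,1-\alpha)$ and $I_\alpha(t)=1$ otherwise. $\Omega_\alpha$ is the closure in $\{0,1\}^{\mathbb Z}$ (product topology) of $\{(I_\alpha(R_\alpha^n(t)))_{n\in\mathbb Z}: t\in[0,1)\}$, and $S$ is the left shift $(Sx)_n=x_{n+1}$; $(\Omega_\alpha,S)$ is minimal and uniquely ergodic. For a word $u$, $[u]=\{x\in\Omega_\alpha: x_0\cdots x_{|u|-1}=u\}$. For a map $T$ on a probability space and a measurable set $U$, $\tau(U)=\inf\{k\geq 1: T^kU\cap U\neq\emptyset\}$. For a finite measurable partition $\zeta$, $\zeta_n=\zeta\vee T^{-1}\zeta\vee\cdots\vee T^{-n+1}\zeta$, $\zeta_n(x)$ is the atom of $\zeta_n$ containing $x$, and $\underline{\mathcal{R}}_{\zeta}(x)=\liminf_{n\to\infty}\tau(\zeta_n(x))/n$, $\overline{\mathcal{R}}_{\zeta}(x)=\limsup_{n\to\infty}\tau(\zeta_n(x))/n$ (with $T=S$ in (1),(2) and $T=R_\alpha$ in (3)). *)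

(* Defs.v *)
From HB Require Import structures.
From mathcomp Require Import all_boot all_order all_algebra.
From mathcomp Require Import all_classical all_reals all_analysis.
Set Implicit Arguments. Unset Strict Implicit. Unset Printing Implicit Defensive.
Import Order.TTheory GRing.Theory Num.Theory.
Local Open Scope classical_set_scope.
Local Open Scope ring_scope.

Definition fracpart {R : realType} (x : R) : R := x - (Num.floor x)%:~R.

Definition gauss {R : realType} (x : R) : R := fracpart x^-1.

(* partial_quotient alpha k = a_{k+1} where alpha = [0; a_1, a_2, ...] *)
Definition partial_quotient {R : realType} (alpha : R) (k : nat) : int :=
  Num.floor ((iter k gauss alpha)^-1).

Definition bounded_partial_quotients {R : realType} (alpha : R) : Prop :=
  exists M : int, forall k : nat, partial_quotient alpha k <= M.

Definition Rrot {R : realType} (alpha t : R) : R := fracpart (t + alpha).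

(* I_alpha(t) : false = 0, true = 1 *)
Definition Ialpha {R : realType} (alpha t : R) : bool := (1 - alpha <= t).

(* coding sequence of t: n |-> I_alpha(R_alpha^n t), n in Z *)
Definition coding {R : realType} (alpha t : R) : int -> bool :=
  fun n => Ialpha alpha (fracpart (t + n%:~R * alpha)).

(* Omega_alpha : closure in {0,1}^Z (product topology of discrete {0,1})
   of the set of codings; x is in the closure iff every central window
   of x is matched by some coding. *)
Definition Omega {R : realType} (alpha : R) : set (int -> bool) :=
  [set x | forall N : nat, exists2 t : R, 0 <= t < 1 &
     forall n : int, (- (N%:Z) <= n <= N%:Z)%R -> coding alpha t n = x n].

Definition Sshift (x : int -> bool) : int -> bool := fun n => x (n + 1)%R.

Definition cylinders : set (set (int -> bool)) :=
  [set A | exists (n : int) (b : bool), A = [set x | x n = b]].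

Definition seqZ := g_sigma_algebraType cylinders.

Local Open Scope ereal_scope.

(* tau(U) = inf {k >= 1 : T^k U meets U}, inf of empty set = +oo *)
Definition tau {X : Type} {R : realType} (T : X -> X) (U : set X) : \bar R :=
  ereal_inf [set (k%:R)%:E | k in [set k : nat | (1 <= k)%N /\
     exists2 y, U y & U (iter k T y)]].

(* atom zeta_n(x) of the partition zeta_n = zeta v T^-1 zeta v ... v T^-(n-1) zeta
   where zeta = {D & c = false, D & c = true} is a two-set partition of D *)
Definition atom {X : Type} (D : set X) (T : X -> X) (c : X -> bool)
  (n : nat) (x : X) : set X :=
  [set y | D y /\ forall i : nat, (i < n)%N -> c (iter i T y) = c (iter i T x)].

Definition ratio_seq {X : Type} {R : realType} (D : set X) (T : X -> X)
  (c : X -> bool) (x : X) : nat -> \bar R :=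
  fun n => tau T (atom D T c n x) * ((n%:R)%:E)^-1.

Definition lower_rec {X : Type} {R : realType} (D : set X) (T : X -> X)
  (c : X -> bool) (x : X) : \bar R := limn_einf (ratio_seq D T c x).

Definition upper_rec {X : Type} {R : realType} (D : set X) (T : X -> X)
  (c : X -> bool) (x : X) : \bar R := limn_esup (ratio_seq D T c x).

(* Main.v *)
Require Import Defs.
From HB Require Import structures.
From mathcomp Require Import all_boot all_order all_algebra.
From mathcomp Require Import all_classical all_reals all_analysis.
From mathcomp Require Import measurable_realfun zify ring lra.
Set Implicit Arguments. Unset Strict Implicit. Unset Printing Implicit Defensive.
Import Order.TTheory GRing.Theory Num.Theory.
Import numFieldNormedType.Exports.
Local Open Scope classical_set_scope.
Local Open Scope ring_scope.

(** The atoms of [zeta_n] are the gaps between consecutive points [-j alpha mod 1],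
    [0 <= j <= n], and the return time of a gap of length [L] is the first [k]
    with [||k alpha|| < L]; it is therefore a denominator [q_k] read off from [L]
    by best approximation.  Bounded partial quotients make all gaps of level [n]
    comparable to [1/n], which bounds [tau/n] at every point.

    The almost sure statements come from a conditional Borel-Cantelli argument:
    if at arbitrarily high levels every gap contains an arc of proportion at
    least [c] on which a given event occurs at a later level, then almost every
    point sees the event infinitely often.  The arcs are found next to an end of
    the gap, where subtracting [q_k alpha] places further points at spacing
    [||q_k alpha||], or in its middle, which these points reach only late.

    The results pass from Lebesgue measure to [mu] because an invariant measure
    gives each cylinder the length of its gap (Denjoy-Koksma counting), and the
    cylinders of the subshift have the return times of the corresponding gaps. *)

(** * Continued fractions *)

Lemma fracpart_itv (R : realType) (x : R) : 0 <= fracpart x < 1.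
Proof.
have := floor_itv x; rewrite /fracpart intrD => /andP[h1 h2].
by apply/andP; split; lra.
Qed.

Lemma fracpart_uniq (R : realType) (x y : R) (z : int) :
  0 <= y < 1 -> x = y + z%:~R -> fracpart x = y.
Proof.
move=> /andP[h1 h2] ->; rewrite /fracpart.
have -> : Num.floor (y + z%:~R) = z.
  by apply: Num.Theory.floor_def; rewrite intrD; apply/andP; split; lra.
by rewrite addrK.
Qed.

(** Bundles the hypotheses on the angle, so that everything below depends on [theta] alone. *)
Record angle (R : realType) := Angle {
  angle_val :> R;
  angle_itv : 0 < angle_val < 1;
  angle_irr : irrational angle_val }.

Section ContinuedFraction.
Context (R : realType) (theta : angle R).
Local Notation alpha := (angle_val theta).

Let x k : R := iter k gauss alpha.

Lemma irrational_neq (a b : int) : b != 0 -> b%:~R * alpha != a%:~R.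
Proof.
move=> b0; apply/eqP => h; apply: (@angle_irr _ theta).
exists (a%:~R / b%:~R) => //=.
by rewrite rmorphM /= fmorphV /= !ratr_int -h mulrAC divff ?mul1r // intr_eq0.
Qed.

(** Since [x k.+1] is [1 / x k] minus an integer, a rational value of [x k.+1] would make [x k]
    rational. *)
Lemma gauss_iter_irrational k (a b : int) : b != 0 -> b%:~R * x k != a%:~R.
Proof.
elim: k a b => [|k IH] a b b0; first exact: irrational_neq.
apply/eqP => /= h.
have xk0 : x k != 0 by have := IH 0 1 isT; rewrite mul1r.
pose c := a + b * Num.floor (x k)^-1.
have h' : b%:~R * (x k)^-1 = c%:~R.
  by rewrite intrD intrM -h /x /= /gauss /fracpart -/(x k); ring.
have c0 : c != 0.
  apply/eqP => c0; move/eqP: h'.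
  by rewrite c0 mulf_eq0 invr_eq0 (negbTE xk0) intr_eq0 (negbTE b0).
by have := IH b c c0; rewrite -h' -mulrA mulVf // mulr1 eqxx.
Qed.

Lemma gauss_iter_itv k : 0 < x k < 1.
Proof.
case: k => [|k]; first exact: angle_itv.
have /andP[h1 h2] := fracpart_itv (x k)^-1.
rewrite /x /= /gauss -/(x k) h2 andbT lt_neqAle h1 andbT eq_sym.
by have := @gauss_iter_irrational k.+1 0 1 isT; rewrite mul1r.
Qed.

Definition quot k : nat := `|partial_quotient alpha k|%N.

Lemma quotE k : (quot k)%:Z = partial_quotient alpha k.
Proof.
rewrite /quot gez0_abs // /partial_quotient -/(x k).
have /andP[h1 h2] := gauss_iter_itv k.
by rewrite floor_ge_int invr_ge0 ltW.
Qed.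

Lemma quot_gt0 k : (0 < quot k)%N.
Proof.
rewrite -ltz_nat quotE /partial_quotient -/(x k).
have /andP[h1 h2] := gauss_iter_itv k.
have : (1 <= Num.floor (x k)^-1); last by lia.
by rewrite floor_ge_int /= invf_ge1 // ltW.
Qed.

(* Continuants, indexed one step later than usual: [cfrec 0 1] lists
   [q_(-1), q_0, q_1, ...] and [cfrec 1 0] lists [p_(-1), p_0, p_1, ...]. *)
Fixpoint cfrec (u v : nat) (k : nat) : nat :=
  match k with
  | 0 => u
  | 1 => v
  | (k'.+1 as k1).+1 => (quot k' * cfrec u v k1 + cfrec u v k')%N
  end.

Definition cfden := cfrec 0 1.
Definition cfnum := cfrec 1 0.

(* [cfdel k = |q_(k-1) alpha - p_(k-1)|] *)
Definition cfdel k : R := \prod_(i < k) x i.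

Local Notation Q := cfden.
Local Notation P := cfnum.
Local Notation del := cfdel.

Lemma QE k : Q k.+2 = (quot k * Q k.+1 + Q k)%N. Proof. by []. Qed.
Lemma PE k : P k.+2 = (quot k * P k.+1 + P k)%N. Proof. by []. Qed.

Lemma delS k : del k.+1 = del k * x k.
Proof. by rewrite /cfdel big_ord_recr. Qed.

Lemma del0 : del 0 = 1. Proof. by rewrite /cfdel big_ord0. Qed.

Lemma del_gt0 k : 0 < del k.
Proof. by apply: prodr_gt0 => i _; case/andP: (gauss_iter_itv i). Qed.

Lemma del_rec k : del k.+2 = del k - (quot k)%:R * del k.+1.
Proof.
rewrite !delS; have /andP[h1 h2] := gauss_iter_itv k.
have -> : x k.+1 = (x k)^-1 - (quot k)%:R.
  by rewrite /x /= /gauss -/(x k) /fracpart -[(quot k)%:R]/((quot k)%:Z%:~R) quotE.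
rewrite mulrBr -mulrA mulfV ?gt_eqF //; ring.
Qed.

Lemma delS_lt k : del k.+1 < del k.
Proof.
have /andP[h1 h2] := gauss_iter_itv k; have := del_gt0 k.
by rewrite delS => h; rewrite -[ltRHS]mulr1 ltr_pM2l.
Qed.

Lemma del_split k : del k.+1 + del k.+2 <= del k.
Proof.
rewrite del_rec; have := del_gt0 k.+1; have := quot_gt0 k.
rewrite -(ler_nat R) => h1 h2; have := ler_wpM2r (ltW h2) h1; lra.
Qed.

Lemma del_leD k i : del (k + i) <= del k.
Proof.
elim: i => [|i IH]; first by rewrite addn0.
by rewrite addnS (le_trans _ IH) // ltW // delS_lt.
Qed.

(** The signed errors obey the recurrence of the continuants, which the alternating sign turns into
    [del_rec]. *)
Lemma approx_sign k :
  (Q k)%:R * alpha - (P k)%:R = (-1) ^+ k.+1 * del k.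
Proof.
elim/ltn_ind: k => -[_|[_|k IH]].
- by rewrite del0 -[Q 0]/0%N -[P 0]/1%N expr1; ring.
- by rewrite delS del0 -[Q 1]/1%N -[P 1]/0%N -[x 0]/alpha sqrrN expr1n; ring.
rewrite QE PE del_rec !natrD !natrM.
have h1 := IH k.+1 (ltnSn _); have h2 := IH k (leqnSn _).
transitivity ((quot k)%:R * ((Q k.+1)%:R * alpha - (P k.+1)%:R)
              + ((Q k)%:R * alpha - (P k)%:R)); first by ring.
by rewrite h1 h2 !exprS; ring.
Qed.

Lemma det_continuants k :
  (Q k.+1)%:Z * (P k)%:Z - (Q k)%:Z * (P k.+1)%:Z = (-1) ^+ k.
Proof.
elim: k => [|k IH]; first by rewrite expr0.
by rewrite QE PE exprS -IH !PoszD !PoszM; ring.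
Qed.

(** The recurrences of [Q] and [del] cancel, so the left-hand side is the same for all [k]. *)
Lemma Q_del k : (Q k.+1)%:R * del k + (Q k)%:R * del k.+1 = 1.
Proof.
elim: k => [|k IH]; first by rewrite del0 -[Q 0]/0%N -[Q 1]/1%N; ring.
by rewrite QE del_rec natrD natrM -[RHS]IH; ring.
Qed.

Lemma Q_gt0 k : (0 < Q k.+1)%N.
Proof.
elim: k => [//|k IH]; rewrite QE.
by have := quot_gt0 k; nia.
Qed.

Lemma Q_fib k : (Q k.+1 + Q k <= Q k.+2)%N.
Proof. by rewrite QE; have := quot_gt0 k; nia. Qed.

Lemma Q_leS k : (Q k <= Q k.+1)%N.
Proof. by case: k => [//|k]; have := Q_fib k; lia. Qed.

Lemma Q_ge k : (k <= Q k.+1)%N.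
Proof.
elim/ltn_ind: k => -[//|[_|k IH]]; first exact: Q_gt0.
by have := Q_fib k.+1; have := IH _ (ltnSn k.+1); have := Q_gt0 k; lia.
Qed.

Lemma Q_grow k : (4 * Q k <= Q (k + 4))%N.
Proof.
rewrite -[4%N]/(2 + 2)%N addnA.
have h i : (2 * Q i <= Q (i + 2))%N.
  by rewrite addn2; have := Q_fib i; have := Q_leS i; lia.
by have := h k; have := h (k + 2)%N; lia.
Qed.

Lemma Q_bracket n : (Q 1 <= n)%N -> exists k, (Q k.+1 <= n < Q k.+2)%N.
Proof.
move=> n1; have ex : exists k, (n < Q k.+1)%N by exists n.+1; exact: Q_ge.
case: (ex_minnP ex) => -[|k] hk hmin; first by rewrite ltnNge n1 in hk.
exists k; rewrite hk andbT leqNgt; apply/negP => h.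
by have := hmin _ h; rewrite ltnn.
Qed.

Lemma del_le_inv k : del k <= (Q k.+1)%:R^-1.
Proof.
rewrite -[leRHS]mul1r ler_pdivlMr ?ltr0n ?Q_gt0 //.
have := Q_del k; have : 0 <= (Q k)%:R * del k.+1 by rewrite mulr_ge0 // ltW // del_gt0.
by rewrite [del k * _]mulrC; lra.
Qed.

(** Expand [(j, m)] in the basis of two consecutive convergents. The coefficients have opposite
    signs, and so do the two errors, so the contributions add up instead of cancelling. *)
Lemma best_approximation k (j : nat) (m : int) :
  (0 < j < Q k.+1)%N -> del k <= `|j%:R * alpha - m%:~R|.
Proof.
move=> /andP[j0 jQ].
set s : int := (-1) ^+ k.
have ss : s * s = 1 by rewrite /s -expr2 sqrr_sign.
(* Cramer's rule; the determinant is the sign [s], so the coefficients are integers. *)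
pose u := s * (m * (Q k.+1)%:Z - j%:Z * (P k.+1)%:Z).
pose v := s * (j%:Z * (P k)%:Z - m * (Q k)%:Z).
have det := det_continuants k; rewrite -/s in det.
have hj : j%:Z = u * (Q k)%:Z + v * (Q k.+1)%:Z.
  transitivity (j%:Z * (s * s)); first by rewrite ss mulr1.
  rewrite {2}/s -/s -det /u /v -det; ring.
have hm : m = u * (P k)%:Z + v * (P k.+1)%:Z.
  transitivity (m * (s * s)); first by rewrite ss mulr1.
  rewrite {2}/s -/s -det /u /v -det; ring.
clearbody u v.
have Q0 : 0 < (Q k.+1)%:Z by rewrite ltz_nat Q_gt0.
have Q1 : 0 <= (Q k)%:Z by [].
have j0' : 0 < j%:Z by [].
have jQ' : j%:Z < (Q k.+1)%:Z by rewrite ltz_nat.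
(* If [u] vanished, [j] would be a multiple of [Q k.+1]; if [u] and [v] had the same sign, [j] would
   be negative or at least [Q k + Q k.+1]. *)
have [u0 uv] : u != 0 /\ u * v <= 0.
  move: Q0 Q1 jQ' hj => {hm det}.
  move: (Q k)%:Z (Q k.+1)%:Z => q1 q2 Q0 Q1 jQ' hj.
  have u0 : u != 0.
    apply/eqP => u0; rewrite u0 mul0r add0r in hj.
    by case: (lerP v 0) => v0; nia.
  split=> //.
  by case: (ltrgtP u 0) u0 => // u1 _; case: (ltrgtP v 0) => // v1; nia.
pose sR : R := (-1) ^+ k.
have e : j%:R * alpha - m%:~R = sR * (v%:~R * del k.+1 - u%:~R * del k).
  rewrite -[j%:R]/(j%:Z%:~R) hj hm !intrD !intrM -!pmulrn.
  transitivity (u%:~R * ((Q k)%:R * alpha - (P k)%:R)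
     + v%:~R * ((Q k.+1)%:R * alpha - (P k.+1)%:R) : R); first by ring.
  by rewrite !approx_sign !exprS -/sR; ring.
rewrite e normrM /sR normrX normrN1 expr1n mul1r.
have d0 := del_gt0 k; have d1 := del_gt0 k.+1.
case: (ltrgtP u 0) u0 => // u1 _.
- have v0 : 0 <= v by nia.
  have : (v%:~R : R) >= 0 by rewrite ler0z.
  have : (u%:~R : R) <= -1 by rewrite -[(-1) : R]/((-1)%:~R) ler_int; lia.
  move=> h1 h2; apply: le_trans (ler_norm _).
  by nra.
- have v0 : v <= 0 by nia.
  have : (v%:~R : R) <= 0 by rewrite lerz0.
  have : (1 : R) <= (u%:~R : R) by rewrite -[(1) : R]/((1)%:~R) ler_int; lia.
  move=> h1 h2; rewrite -normrN; apply: le_trans (ler_norm _).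
  by nra.
Qed.

End ContinuedFraction.

(** * Gaps of the orbit and return times *)

Section Gaps.
Context (R : realType) (theta : angle R).
Local Notation alpha := (angle_val theta).
Local Notation Q := (cfden theta).
Local Notation P := (cfnum theta).
Local Notation del := (cfdel theta).

(** The parity of [k] matters only through the side to which [Q k * alpha] moves a point; this form
    feeds the left and right cases of the geometric arguments. *)
Lemma approx_cases k :
  ((Q k)%:R * alpha - (P k)%:R = del k
    /\ (Q k.+1)%:R * alpha - (P k.+1)%:R = - del k.+1) \/
  ((Q k)%:R * alpha - (P k)%:R = - del k
    /\ (Q k.+1)%:R * alpha - (P k.+1)%:R = del k.+1).
Proof.
rewrite !approx_sign !exprS; have := signr_odd R k.
by case: odd => <-; rewrite ?expr1 ?expr0; [left|right]; split; ring.
Qed.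

(** Adding [Q k * alpha] moves a point by [del k] modulo 1, always in the same direction, so it
    cannot jump over a half-open arc of that length. *)
Lemma orbit_hits k (t a : R) :
  exists (j : nat) (z : int), a <= t + j%:R * alpha - z%:~R < a + del k.
Proof.
have d0 : 0 < del k := del_gt0 theta k.
have zc : forall y : R, y <= (Num.ceil y)%:~R by move=> y; have /andP[] := ceil_itv y.
have fl : forall y : R, (Num.floor y)%:~R <= y by move=> y; have /andP[] := floor_itv y.
have [[h _]|[h _]] := approx_cases k.
(* The translate by [z0] starts to the left of [a]; [y] is its distance to [a] in steps of
   [del k]. *)
- pose z0 := Num.ceil (t - a); pose y := (a - t + z0%:~R) / del k.
  have y0 : 0 <= y by apply: divr_ge0; last exact: ltW; have := zc (t - a); rewrite /z0; lra.
  have /andP[h1 h2] := ceil_itv y.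
  have c0 : 0 <= Num.ceil y by rewrite -(ler_int R) (le_trans y0).
  pose i := `|Num.ceil y|%N.
  have iE : i%:R = (Num.ceil y)%:~R :> R by rewrite -[i%:R]/(i%:Z%:~R) gez0_abs.
  exists (i * Q k)%N, (z0 + (i * P k)%N).
  have -> : t + (i * Q k)%:R * alpha - (z0 + (i * P k)%N)%:~R = t - z0%:~R + i%:R * del k.
    by rewrite -h intrD natrM -pmulrn natrM; ring.
  rewrite iE; rewrite intrB in h1.
  have yd : y * del k = a - t + z0%:~R by rewrite /y divfK // gt_eqF.
  have := ler_wpM2r (ltW d0) h2; have : (Num.ceil y)%:~R * del k < (y + 1) * del k.
    by rewrite ltr_pM2r //; lra.
  by rewrite mulrDl yd; move=> *; apply/andP; split; lra.
- pose z0 := Num.floor (t - a); pose y := (t - z0%:~R - a) / del k.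
  have y0 : 0 <= y by apply: divr_ge0; last exact: ltW; have := fl (t - a); rewrite /z0; lra.
  have /andP[h1 h2] := floor_itv y.
  have c0 : 0 <= Num.floor y by rewrite floor_ge0.
  pose i := `|Num.floor y|%N.
  have iE : i%:R = (Num.floor y)%:~R :> R by rewrite -[i%:R]/(i%:Z%:~R) gez0_abs.
  exists (i * Q k)%N, (z0 + (i * P k)%N).
  have -> : t + (i * Q k)%:R * alpha - (z0 + (i * P k)%N)%:~R = t - z0%:~R - i%:R * del k.
    transitivity (t - z0%:~R + i%:R * (- del k)); last by ring.
    by rewrite -h intrD natrM -pmulrn natrM; ring.
  rewrite iE; rewrite intrD in h2.
  have yd : y * del k = t - z0%:~R - a by rewrite /y divfK // gt_eqF.
  have := ler_wpM2r (ltW d0) h1; have : (y - 1) * del k < (Num.floor y)%:~R * del k.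
    by rewrite ltr_pM2r //; lra.
  by rewrite mulrBl yd; move=> *; apply/andP; split; lra.
Qed.

(* The first hitting time of an arc of length [del k] is below
   [Q k + Q k.+1]: from a later hit one can step back by [Q k.+1] or by
   [Q k + Q k.+1] and still be in the arc. *)
Lemma orbit_covers k (t a : R) :
  exists (j : nat) (z : int), (j < Q k + Q k.+1)%N /\
    a <= t + j%:R * alpha - z%:~R < a + del k.
Proof.
pose hit j := `[< exists z : int, a <= t + j%:R * alpha - z%:~R < a + del k >].
have ex : exists j, hit j.
  by have [j [z h]] := orbit_hits k t a; exists j; apply/asboolP; exists z.
case: (ex_minnP ex) => j /asboolP[z hz] jmin.
exists j, z; split => //; rewrite ltnNge; apply/negP => jQ.
have Q1 := Q_gt0 theta k; have d0 := del_gt0 theta k; have d1 := del_gt0 theta k.+1; have d01 := delS_lt theta k.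
have back1 (z' : int) : ~ (a <= t + (j - Q k.+1)%:R * alpha - z'%:~R < a + del k).
  move=> h; have : hit (j - Q k.+1)%N by apply/asboolP; exists z'.
  by move/jmin; lia.
have back2 (z' : int) : ~ (a <= t + (j - (Q k + Q k.+1))%:R * alpha - z'%:~R < a + del k).
  move=> h; have : hit (j - (Q k + Q k.+1))%N by apply/asboolP; exists z'.
  by move/jmin; lia.
have := back1 (z - (P k.+1)%:Z); have := back2 (z - (P k + P k.+1)%N%:Z).
rewrite !natrB ?intrB -?pmulrn ?natrD //; last by lia.
set y := t + j%:R * alpha - z%:~R in hz.
have [[h h']|[h h']] := approx_cases k.
- have -> : t + (j%:R - ((Q k)%:R + (Q k.+1)%:R)) * alpha - (z%:~R - ((P k)%:R + (P k.+1)%:R))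
    = y - del k + del k.+1 by rewrite -[del k.+1]opprK -h -h' /y; ring.
  have -> : t + (j%:R - (Q k.+1)%:R) * alpha - (z%:~R - (P k.+1)%:R) = y + del k.+1.
    by rewrite -[del k.+1]opprK -h' /y; ring.
  case/andP: hz => hz1 hz2 b2 b1; case: (ltrP (y + del k.+1) (a + del k)) => hy.
  + by apply: b1; rewrite hy andbT; lra.
  + by apply: b2; apply/andP; split; lra.
- have -> : t + (j%:R - ((Q k)%:R + (Q k.+1)%:R)) * alpha - (z%:~R - ((P k)%:R + (P k.+1)%:R))
    = y + del k - del k.+1 by rewrite -[del k]opprK -h -h' /y; ring.
  have -> : t + (j%:R - (Q k.+1)%:R) * alpha - (z%:~R - (P k.+1)%:R) = y - del k.+1.
    by rewrite -h' /y; ring.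
  case/andP: hz => hz1 hz2 b2 b1; case: (lerP a (y - del k.+1)) => hy.
  + by apply: b1; rewrite hy /=; lra.
  + by apply: b2; apply/andP; split; lra.
Qed.

(** The backward orbit of 0 is lifted to the real line with all its integer translates, so that no
    gap wraps around. *)
Definition orb (n : nat) (y : R) : Prop :=
  exists (j : nat) (z : int), (j <= n)%N /\ y = z%:~R - j%:R * alpha.

Definition gap (n : nat) (t lo hi : R) : Prop :=
  [/\ lo <= t < hi, orb n lo, orb n hi & forall y, orb n y -> y <= lo \/ hi <= y].

Lemma orb_le n m y : (n <= m)%N -> orb n y -> orb m y.
Proof. by move=> nm [j [z [jn ->]]]; exists j, z; split=> //; exact: leq_trans nm. Qed.

(** Level [n.+1] adds the translates of a single point; only the last one up to [t] and the first
    one after [t] can shorten the gap around [t]. *)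
Lemma gap_exists n t : exists lo hi, gap n t lo hi.
Proof.
elim: n => [|n [lo [hi [tlh olo ohi sep]]]].
  have /andP[h1 h2] := floor_itv t; rewrite intrD in h2.
  exists (Num.floor t)%:~R, ((Num.floor t)%:~R + 1); split.
  - by rewrite h1.
  - by exists 0%N, (Num.floor t); rewrite mul0r subr0.
  - by exists 0%N, (Num.floor t + 1); rewrite mul0r subr0 intrD.
  - move=> y [j [z [+ ->]]]; rewrite leqn0 => /eqP ->; rewrite mul0r subr0.
    case: (lerP z (Num.floor t)) => hz; [left|right]; first by rewrite ler_int.
    by rewrite -[1]/(1%:~R) -intrD ler_int; lia.
pose f := Num.floor (t + n.+1%:R * alpha).
have /andP[h1 h2] := floor_itv (t + n.+1%:R * alpha); rewrite -/f intrD in h1 h2.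
exists (Num.max lo (f%:~R - n.+1%:R * alpha)), (Num.min hi ((f + 1)%:~R - n.+1%:R * alpha)).
case/andP: tlh => h3 h4; split.
- rewrite ge_max lt_min h3 h4 intrD /=; apply/andP; split; lra.
- case: (leP lo) => _; last exact: (orb_le (leqnSn n)).
  by exists n.+1, f.
- case: (leP hi) => _; first exact: (orb_le (leqnSn n)).
  by exists n.+1, (f + 1).
move=> y [j [z [+ ->]]]; rewrite leq_eqVlt ltnS => /orP[/eqP ->|jn].
  case: (lerP z f) => hz; [left|right].
  - by rewrite le_max orbC lerB // ler_int.
  - by rewrite ge_min orbC lerB // ler_int; lia.
case: (sep (z%:~R - j%:R * alpha)); first by exists j, z.
- by move=> h; left; rewrite le_max h.
- by move=> h; right; rewrite ge_min h.
Qed.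

(** The difference of two orbit points has the form [j * alpha - m] up to sign with [j] below
    [Q k.+1], so best approximation applies unless [j = 0]. *)
Lemma orb_sep n k y y' : (n < Q k.+1)%N -> orb n y -> orb n y' -> y < y' ->
  del k <= y' - y.
Proof.
move=> nQ [j [z [jn ->]]] [j' [z' [jn' ->]]] lt.
case: (ltngtP j j') => jj.
- have /le_trans := @best_approximation _ theta k (j' - j)%N (z' - z) ltac:(lia).
  apply; rewrite natrB 1?ltnW // intrB distrC ger0_norm; lra.
- have /le_trans := @best_approximation _ theta k (j - j')%N (z - z') ltac:(lia).
  apply; rewrite natrB 1?ltnW // intrB ger0_norm; lra.
(* Here the points differ by a nonzero integer, and [del k <= del 0 = 1]. *)
- have : z%:~R < z'%:~R :> R by rewrite jj in lt; lra.
  rewrite ltr_int jj => zz; have : (z + 1)%:~R <= z'%:~R :> R by rewrite ler_int; lia.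
  rewrite intrD => h; have := del_leD theta 0 k; rewrite add0n del0; lra.
Qed.

Lemma gap_ge n k t lo hi : gap n t lo hi -> (n < Q k.+1)%N -> del k <= hi - lo.
Proof.
by move=> [/andP[h1 h2] olo ohi _] nQ; apply: orb_sep nQ olo ohi _; lra.
Qed.

Lemma gap_le n k t lo hi : gap n t lo hi -> (Q k + Q k.+1 <= n.+1)%N ->
  hi - lo <= del k.
Proof.
move=> [_ _ _ sep] nQ; rewrite leNgt; apply/negP => lt.
(* The forward orbit of [- n * alpha] stays among the orbit points of level [n] for [n] steps, hence
   would enter the last part, of length [del k], of a longer gap. *)
have [j [z [jQ /andP[h1 h2]]]] := orbit_covers k (- (n%:R * alpha)) (hi - del k).
have jn : (j <= n)%N by lia.
have := sep (- (n%:R * alpha) + j%:R * alpha - z%:~R).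
case; last 2 first.
- lra.
- lra.
by exists (n - j)%N, (- z); split; [lia|rewrite natrB // intrN; ring].
Qed.

Lemma gap_itv n t lo hi : 0 <= t < 1 -> gap n t lo hi -> 0 <= lo /\ hi <= 1.
Proof.
move=> /andP[t0 t1] [/andP[h1 h2] _ _ sep]; split.
- have [] := sep 0; [by exists 0%N, 0; rewrite mul0r subr0|by []|lra].
- have [] := sep 1; [by exists 0%N, 1; rewrite mul0r subr0|lra|by []].
Qed.

(** The letter 1 marks the steps at which the rotation wraps around, that is, at which the lifted
    orbit passes an integer. *)
Lemma floor_coding (t : R) (i : nat) :
  Num.floor (t + i.+1%:R * alpha) =
  Num.floor (t + i%:R * alpha) + (coding alpha t i%:Z)%:Z.
Proof.
have /andP[a0 a1] := angle_itv theta.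
have /andP[h1 h2] := floor_itv (t + i%:R * alpha); rewrite intrD in h2.
apply: Num.Theory.floor_def; rewrite /coding /Ialpha /fracpart -pmulrn !intrD.
rewrite -natr1.
by case: (lerP (1 - alpha)) => /= h; apply/andP; split; lra.
Qed.

Lemma coding_floorP (t y : R) n : 0 <= t < 1 -> 0 <= y < 1 ->
  (forall i, (i < n)%N -> coding alpha y i%:Z = coding alpha t i%:Z) <->
  (forall j, (j <= n)%N -> Num.floor (y + j%:R * alpha) = Num.floor (t + j%:R * alpha)).
Proof.
move=> ht hy; split=> h.
- elim=> [_|j IH jn]; last by rewrite !floor_coding IH 1?ltnW // h.
  by rewrite mul0r !addr0 !(@Num.Theory.floor_def _ _ 0).
- move=> i ilt; have := h i.+1 ilt; rewrite !floor_coding h 1?ltnW //.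
  by do 2 case: coding => //=; lia.
Qed.

Definition cyl (n : nat) (x : int -> bool) : set R :=
  [set t | 0 <= t < 1 /\ forall i, (i < n)%N -> coding alpha t i%:Z = x i%:Z].

(** Two points share their first [n] letters exactly when the floors agree up to [j = n], that is,
    when no orbit point of level [n] separates them. Words of length [n] thus belong to the points
    with [0 <= j <= n]. *)
Lemma gap_cyl n t lo hi : 0 <= t < 1 -> gap n t lo hi ->
  cyl n (coding alpha t) = [set y | lo <= y < hi].
Proof.
move=> ht g; have [lo0 hi1] := gap_itv ht g.
case: (g) => /andP[h1 h2] [j1 [z1 [jn1 e1]]] [j2 [z2 [jn2 e2]]] sep.
apply/seteqP; split=> [y [hy] /(coding_floorP _ ht hy) hf|y /= /andP[hy1 hy2]].
- apply/andP; split.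
  + rewrite e1 lerBlDr -floor_ge_int hf // floor_ge_int; lra.
  + rewrite e2 ltrBrDr -floor_lt_int hf // floor_lt_int; lra.
- have hy : 0 <= y < 1 by apply/andP; split; lra.
  split=> //; apply/(coding_floorP _ ht hy) => j jn.
  have /andP[h3 h4] := floor_itv (t + j%:R * alpha).
  set f := Num.floor (t + j%:R * alpha) in h3 h4 *.
  apply: Num.Theory.floor_def; apply/andP; split.
  + by case: (sep (f%:~R - j%:R * alpha)); [exists j, f|lra|lra].
  + by case: (sep ((f + 1)%:~R - j%:R * alpha)); [exists j, (f + 1)|lra|lra].
Qed.

Lemma iter_Rrot (t : R) i : 0 <= t < 1 ->
  iter i (Rrot alpha) t = fracpart (t + i%:R * alpha).
Proof.
move=> ht; elim: i => [|i IH].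
  by rewrite mul0r addr0 /= (@fracpart_uniq _ _ t 0) // addr0.
rewrite iterS IH /Rrot.
have FE : fracpart (t + i%:R * alpha) =
  t + i%:R * alpha - (Num.floor (t + i%:R * alpha))%:~R by [].
move: (fracpart _) FE => F FE; symmetry.
apply: (@fracpart_uniq _ _ _ (Num.floor (F + alpha) + Num.floor (t + i%:R * alpha)));
  first exact: fracpart_itv.
by rewrite intrD /fracpart {1}FE -natr1; ring.
Qed.

Lemma atom_cyl n (t : R) : 0 <= t < 1 ->
  atom [set t : R | 0 <= t < 1] (Rrot alpha) (Ialpha alpha) n t =
  cyl n (coding alpha t).
Proof.
move=> ht; apply/seteqP; split=> y [hy h]; split=> // i ilt.
- by have := h i ilt; rewrite !iter_Rrot.
- by have := h i ilt; rewrite !iter_Rrot.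
Qed.

Local Open Scope ereal_scope.

(** A return at time [j] brings [j * alpha] closer to an integer than the length of the gap, which
    best approximation excludes before [Q k.+1]. *)
Lemma tau_ge_gap n k (t lo hi : R) : (0 <= t < 1)%R -> gap n t lo hi ->
  (hi - lo <= del k)%R ->
  (Q k.+1)%:R%:E <= tau (Rrot alpha) (cyl n (coding alpha t)) :> \bar R.
Proof.
move=> ht g le; have [lo0 hi1] := gap_itv ht g.
rewrite /tau; apply: le_ereal_inf_tmp => _ [j [j1 [y]]] + + <-.
rewrite (gap_cyl ht g) /= => /andP[h1 h2].
have hy : (0 <= y < 1)%R by apply/andP; split; lra.
rewrite iter_Rrot // => /andP[h3 h4]; rewrite lee_fin ler_nat leqNgt.
apply/negP => jQ.
have := @best_approximation _ theta k j (Num.floor (y + j%:R * alpha)).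
rewrite j1 jQ /= => /(_ isT); rewrite /fracpart in h3 h4.
by rewrite leNgt => /negP; apply; rewrite ltr_norml; apply/andP; split; lra.
Qed.

(** A displacement by [del k] fits inside the gap. The case [k = 0] is left out because [Q 0 = 0] is
    not a return time. *)
Lemma tau_le_gap n k (t lo hi : R) : (0 <= t < 1)%R -> gap n t lo hi ->
  (0 < k)%N -> (del k < hi - lo)%R ->
  tau (Rrot alpha) (cyl n (coding alpha t)) <= (Q k)%:R%:E :> \bar R.
Proof.
move=> ht g k0 lt; have [lo0 hi1] := gap_itv ht g.
have d0 := del_gt0 theta k.
rewrite /tau; apply: ereal_inf_lbound; exists (Q k) => //=; split.
  by case: k k0 {lt d0} => // k _; exact: Q_gt0.
rewrite (gap_cyl ht g).
(* The returning point is the left end or the point [del k] to its right, according to the direction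
   of the move. *)
have [[h _]|[h _]] := approx_cases k.
- exists lo => /=; first by apply/andP; split; lra.
  rewrite iter_Rrot; last by apply/andP; split; lra.
  rewrite (@fracpart_uniq _ _ (lo + del k)%R (P k)); first by apply/andP; split; lra.
  + by apply/andP; split; lra.
  + by rewrite -h -pmulrn; ring.
- exists (lo + del k)%R => /=; first by apply/andP; split; lra.
  rewrite iter_Rrot; last by apply/andP; split; lra.
  rewrite (@fracpart_uniq _ _ lo (P k)); first by apply/andP; split; lra.
  + by apply/andP; split; lra.
  + by rewrite -[del k]opprK -h -pmulrn; ring.
Qed.

End Gaps.

(** * Arcs with prescribed return times *)

Section Arcs.
Context (R : realType) (theta : angle R).
Local Notation alpha := (angle_val theta).
Local Notation Q := (cfden theta).
Local Notation P := (cfnum theta).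
Local Notation del := (cfdel theta).
Local Notation gap := (gap theta).
Local Notation orb := (orb theta).

Lemma gap_within n y lo hi u v : gap n y lo hi -> orb n u -> orb n v ->
  u <= y < v -> u <= lo /\ hi <= v.
Proof.
move=> [/andP[h1 h2] _ _ sep] /sep + /sep + /andP[uy yv].
by move=> [?|?] [?|?]; split; lra.
Qed.

Lemma orb_shift n k i y : orb n y ->
  orb (n + i * Q k) (y - i%:R * ((Q k)%:R * alpha - (P k)%:R)).
Proof.
move=> [j [z [jn ->]]]; exists (j + i * Q k)%N, (z + (i * P k)%N%:Z).
by rewrite leq_add2r; split=> //; rewrite natrD natrM intrD -pmulrn natrM; ring.
Qed.

(** Subtracting [Q k * alpha] up to [s] times from one end of the gap places points at spacing
    [del k] going inwards. They cut an arc of length [s * del k], or the whole gap if it is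
    shorter. *)
Lemma short_gaps_at_end n k s t lo hi : gap n t lo hi ->
  exists a b, [/\ lo <= a, b <= hi, Num.min (hi - lo) (s%:R * del k) <= b - a &
    forall y, a <= y < b -> exists lo' hi',
      gap (n + s * Q k) y lo' hi' /\ hi' - lo' <= del k].
Proof.
move=> g; have [/andP[h1 h2] olo ohi _] := g; have d0 := del_gt0 theta k.
(* It suffices to enclose [y] between two available orbit points at distance at most [del k]. *)
have fin y i u v : (i <= s)%N -> orb (n + i * Q k) u -> orb (n + s * Q k) v ->
    u <= y < v -> v - u <= del k -> exists lo' hi',
      gap (n + s * Q k) y lo' hi' /\ hi' - lo' <= del k.
  move=> ilt ou ov uyv uv; have [lo' [hi' g']] := gap_exists theta (n + s * Q k) y.
  have ou' : orb (n + s * Q k) u by apply: orb_le ou; rewrite leq_add2l leq_mul2r ilt orbT.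
  have [? ?] := gap_within g' ou' ov uyv.
  by exists lo', hi'; split=> //; lra.
have [[h _]|[h _]] := approx_cases theta k.
- exists (Num.max lo (hi - s%:R * del k)), hi; split=> //.
  + by rewrite le_max lexx.
  + by case: (leP lo (hi - s%:R * del k)) => ?; rewrite ge_min; apply/orP; [right|left]; lra.
  move=> y /andP[]; rewrite ge_max => /andP[y1 y2] y3.
  (* Rounding up counts the steps from [hi] down to the first point not above [y]. *)
  pose w := (hi - y) / del k.
  have wd : w * del k = hi - y by rewrite /w divfK // gt_eqF.
  have w0 : 0 < w by rewrite divr_gt0 //; lra.
  have /andP[c1 c2] := ceil_itv w; rewrite intrB in c1.
  have cs : Num.ceil w <= s%:Z.
    by rewrite ceil_le_int -pmulrn /w ler_pdivrMr //; lra.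
  have c0 : 0 < Num.ceil w by rewrite -(ltr_int R); exact: lt_le_trans c2.
  pose i := `|Num.ceil w|%N.
  have iE : (Num.ceil w)%:~R = i%:R :> R by rewrite -[i%:R]/(i%:Z%:~R) gez0_abs // ltW.
  have i0 : (0 < i)%N by rewrite -ltz_nat gez0_abs // ltW.
  have is' : (i <= s)%N by rewrite -lez_nat gez0_abs // ltW.
  rewrite iE in c1 c2.
  have := ler_wpM2r (ltW d0) c2; have : (i%:R - 1) * del k < w * del k by rewrite ltr_pM2r.
  rewrite mulrBl wd => e1 e2.
  have i1 : (i.-1 <= s)%N by lia.
  have iR : (i.-1)%:R = i%:R - 1 :> R by rewrite -(prednK i0) /= -natr1 addrK.
  apply: (fin y i (hi - i%:R * del k) (hi - (i.-1)%:R * del k)) => //.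
  + by rewrite -h; exact: orb_shift.
  + apply: (@orb_le _ _ (n + i.-1 * Q k)); first by rewrite leq_add2l leq_mul2r i1 orbT.
    by rewrite -h; exact: orb_shift.
  + by rewrite iR; apply/andP; split; lra.
  + by rewrite iR; lra.
- exists lo, (Num.min hi (lo + s%:R * del k)); split=> //.
  + by rewrite ge_min lexx.
  + by case: (leP hi (lo + s%:R * del k)) => ?; rewrite ge_min; apply/orP; [left|right]; lra.
  move=> y /andP[y1]; rewrite lt_min => /andP[y2 y3].
  pose w := (y - lo) / del k.
  have wd : w * del k = y - lo by rewrite /w divfK // gt_eqF.
  have w0 : 0 <= w by rewrite divr_ge0 //; lra.
  have /andP[c1 c2] := truncn_itv w0.
  have is' : (Num.truncn w < s)%N.
    by rewrite -(ltr_nat R) (le_lt_trans c1) // /w ltr_pdivrMr //; lra.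
  have := ler_wpM2r (ltW d0) c1; have : w * del k < (Num.truncn w).+1%:R * del k.
    by rewrite ltr_pM2r.
  rewrite wd => e1 e2.
  apply: (fin y (Num.truncn w) (lo + (Num.truncn w)%:R * del k)
              (lo + (Num.truncn w).+1%:R * del k)) => //.
  + exact: ltnW.
  + by rewrite -[del k]opprK -h mulrN; exact: orb_shift.
  + apply: (@orb_le _ _ (n + (Num.truncn w).+1 * Q k)).
      by rewrite leq_add2l leq_mul2r is' orbT.
    by rewrite -[del k]opprK -h mulrN; exact: orb_shift.
  + by apply/andP; split; lra.
  + by rewrite -natr1; lra.
Qed.

(* At level [Q k.+2 - 1] distinct orbit points are [del k.+1] apart, so no
   third one fits between two at distance [del k.+1 + del k.+2]. *)
Lemma long_gap_at_end n k t lo hi : gap n t lo hi -> (n < Q k.+1)%N ->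
  exists a b, [/\ lo <= a, b <= hi, b - a = del k.+1 + del k.+2 &
    forall y, a <= y < b -> exists lo' hi',
      gap (Q k.+2).-1 y lo' hi' /\ del k.+1 < hi' - lo'].
Proof.
move=> g nQ; have [/andP[h1 h2] olo ohi _] := g.
have L := gap_ge g nQ; have d := del_split theta k.
have d0 := del_gt0 theta k.+1; have d1 := del_gt0 theta k.+2.
have d2 := delS_lt theta k.+1.
have Q2 := Q_gt0 theta k.+1; have Q12 := Q_leS theta k.+1.
have mQ : ((Q k.+2).-1 < Q k.+2)%N by rewrite prednK.
have fin y a b : orb (Q k.+2).-1 a -> orb (Q k.+2).-1 b ->
    b - a = del k.+1 + del k.+2 -> a <= y < b -> exists lo' hi',
      gap (Q k.+2).-1 y lo' hi' /\ del k.+1 < hi' - lo'.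
  move=> oa ob ab yab; have [lo' [hi' g']] := gap_exists theta (Q k.+2).-1 y.
  exists lo', hi'; split=> //; have [u v] := gap_within g' oa ob yab.
  (* If the gap of [y] did not reach [a] or [b], then [b - a] would contain two disjoint intervals
     of length at least [del k.+1], which exceeds [del k.+1 + del k.+2]. *)
  have L' := gap_ge g' mQ; have [_ olo' ohi' _] := g'.
  have u' : lo' <= a.
    by rewrite leNgt; apply/negP => u'; have := orb_sep mQ oa olo' u'; lra.
  have v' : b <= hi'.
    by rewrite leNgt; apply/negP => v'; have := orb_sep mQ ohi' ob v'; lra.
  by lra.
(* The errors of consecutive convergents have opposite signs, so subtracting
   [(Q k.+2 - Q k.+1) * alpha] moves a point by the sum of both, at a cost in level that stays below
   [Q k.+2]. *)
have sh y : orb n y ->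
    orb (Q k.+2).-1 (y - (((Q k.+2)%:R * alpha - (P k.+2)%:R)
                          - ((Q k.+1)%:R * alpha - (P k.+1)%:R))).
  move=> [j [z [jn ->]]].
  exists (j + (Q k.+2 - Q k.+1))%N, (z + (P k.+2)%:Z - (P k.+1)%:Z).
  split; first by lia.
  by rewrite intrB intrD -!pmulrn natrD natrB //; ring.
have nm : (n <= (Q k.+2).-1)%N by lia.
have [[h h']|[h h']] := approx_cases theta k.+1.
- exists lo, (lo + (del k.+1 + del k.+2)); split=> //; [lra|ring|].
  move=> y yab; apply: (fin y lo) yab; first exact: orb_le olo.
  + by have := sh _ olo; rewrite h h'; congr orb; ring.
  + ring.
- exists (hi - (del k.+1 + del k.+2)), hi; split=> //; [lra|ring|].
  move=> y yab; apply: (fin y _ hi) yab; last ring; last exact: orb_le ohi.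
  by have := sh _ ohi; rewrite h h'; congr orb; ring.
Qed.

(* Orbit points of the levels up to [n + s Q k.+1] lie within [s del k.+1] of
   an orbit point of level [n], hence of an end of the gap. *)
Lemma long_gap_in_middle k s t lo hi y lo' hi' :
  let m := ((Q k.+1).-1 + s * Q k.+1)%N in
  gap (Q k.+1).-1 t lo hi -> lo + s%:R * del k.+1 <= y < hi - s%:R * del k.+1 ->
  gap m y lo' hi' -> hi - lo - (s%:R * del k.+1) *+ 2 <= hi' - lo'.
Proof.
move=> m [_ _ _ sep] /andP[y1 y2] [/andP[l1 l2] olo ohi _].
have Q1 := Q_gt0 theta k; have d0 := del_gt0 theta k.+1.
have noorb v : orb m v -> lo + s%:R * del k.+1 < v < hi - s%:R * del k.+1 -> False.
  move=> [j [z [jm ->]]] /andP[u1 u2].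
  (* The remainder gives a point of the original level, and the quotient, at most [s], counts the
     displacements by [del k.+1]. *)
  pose i := (j %/ Q k.+1)%N; pose r := (j %% Q k.+1)%N.
  have jE : j = (i * Q k.+1 + r)%N by exact: divn_eq.
  have rQ : (r < Q k.+1)%N by rewrite ltn_mod.
  have is' : (i <= s)%N by rewrite /m in jm; nia.
  have : i%:R * del k.+1 <= s%:R * del k.+1.
    by rewrite ler_wpM2r ?ler_nat // ltW.
  have : 0 <= i%:R * del k.+1 by rewrite mulr_ge0 // ltW.
  move=> e1 e2; pose u := (z - (i * P k.+1)%N%:Z)%:~R - r%:R * alpha.
  have ou : orb (Q k.+1).-1 u by exists r, (z - (i * P k.+1)%N%:Z); split=> //; lia.
  have uE : u = z%:~R - j%:R * alpha + i%:R * ((Q k.+1)%:R * alpha - (P k.+1)%:R).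
    by rewrite /u jE intrB -pmulrn natrD !natrM; ring.
  have : lo < u < hi.
    have [[h _]|[h _]] := approx_cases theta k.+1; rewrite uE h ?mulrN;
      by apply/andP; split; lra.
  by case/andP=> v1 v2; case: (sep _ ou); lra.
have a1 : lo' <= lo + s%:R * del k.+1.
  rewrite leNgt; apply/negP => a1; apply: (noorb lo') => //.
  by rewrite a1 /=; lra.
have a2 : hi - s%:R * del k.+1 <= hi'.
  rewrite leNgt; apply/negP => a2; apply: (noorb hi') => //.
  by rewrite a2 andbT; lra.
by rewrite mulr2n; lra.
Qed.

(** A function of the symbolic sequence instead of the point, so that the rotation and the subshift
    share it. *)
Definition tauc (n : nat) (x : int -> bool) : \bar R :=
  tau (Rrot alpha) (cyl theta n x).

(** The input of the Borel-Cantelli argument. The level [m] is the same for all gaps of level [n],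
    and [c] does not depend on the levels. *)
Definition frequent (c : R) (G : nat -> \bar R -> Prop) : Prop :=
  forall n0 : nat, exists n m : nat, (n0 <= n <= m)%N /\
    forall t, 0 <= t < 1 -> exists lo hi a b,
      [/\ gap n t lo hi, lo <= a, b <= hi, c * (hi - lo) <= b - a &
        forall y, a <= y < b -> G m (tauc m (coding alpha y))].

Definition atleast (r : R) (m : nat) (v : \bar R) : Prop := ((r * m%:R)%:E <= v)%E.
Definition atmost (r : R) (m : nat) (v : \bar R) : Prop := (v <= (r * m%:R)%:E)%E.

Lemma sub_itv01 n t lo hi a b y : 0 <= t < 1 -> gap n t lo hi -> lo <= a -> b <= hi ->
  a <= y < b -> 0 <= y < 1.
Proof.
move=> ht g la bh /andP[y1 y2]; have [l0 h1] := gap_itv ht g.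
by apply/andP; split; lra.
Qed.

(** * Arcs with extreme return times for unbounded partial quotients *)

Section Unbounded.
Hypothesis unb : forall A n0, exists k, (n0 <= k)%N /\ (A <= quot theta k)%N.

(** With a large partial quotient [A], about [A / (2 * M)] displacements by [del k.+1] cover a fixed
    proportion of a gap. The return time there is at least [Q k.+2], roughly [A * Q k.+1], while the
    level is still below a fraction [1 / M] of it. *)
Lemma frequent_atleast_unbounded (M : nat) : (0 < M)%N ->
  frequent ((8 * M)%:R^-1) (atleast M%:R).
Proof.
move=> M0 n0; have [k [n0k ak]] := unb (4 * M) n0.
(* As [A >= 4 * M], this gives [s >= 2], hence [M * (s + 2) <= A]; it also gives
   [A + 1 <= 8 * M * s], the source of the proportion. *)
pose s := (quot theta k %/ (2 * M))%N; pose n := (Q k + Q k.+1)%N.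
have QkE := QE theta k; set A := quot theta k in ak QkE s *.
have [s1 s2] : (s * (2 * M) <= A)%N /\ (A < s.+1 * (2 * M))%N.
  by rewrite leq_divM ltn_ceil // muln_gt0.
have s3 : (2 <= s)%N by rewrite /s leq_divRL ?muln_gt0 //; lia.
have Q01 := Q_leS theta k; have Qk := Q_ge theta k; have Q1 := Q_gt0 theta k.
exists n, (n + s * Q k.+1)%N; split; first by rewrite leq_addr andbT /n; lia.
move=> t ht; have [lo [hi g]] := gap_exists theta n t.
have [a [b [la bh ab hy]]] := short_gaps_at_end k.+1 s g.
exists lo, hi, a, b; split=> //; last first.
  move=> y yab; have [lo' [hi' [g' L']]] := hy y yab.
  have hy01 := sub_itv01 ht g la bh yab.
  apply: le_trans (tau_ge_gap hy01 g' L').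
  rewrite lee_fin -natrM ler_nat QkE /n.
  have : (M * (s + 2) <= A)%N by nia.
  by nia.
apply: le_trans ab.
have L : hi - lo <= del k by apply: gap_le g _; rewrite /n.
have L0 : 0 < hi - lo by case: g => /andP[? ?] _ _ _; lra.
have M1 : (1 : R) <= M%:R by rewrite ler1n.
have c1 : (8 * M)%:R^-1 <= 1 :> R by rewrite invf_le1 ?ler1n ?ltr0n; lia.
rewrite le_min; apply/andP; split; first by nra.
have dk := del_rec theta k; have d1 := del_gt0 theta k.+1; have d2 := delS_lt theta k.+1.
rewrite mulrC ler_pdivrMr ?ltr0n ?muln_gt0 ?M0 //.
apply: (le_trans L); have : (A%:R + 1) * del k.+1 <= (s * (8 * M))%:R * del k.+1.
  by rewrite ler_wpM2r ?(ltW d1) // natr1 ler_nat; nia.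
rewrite natrM; rewrite -/A in dk; lra.
Qed.

(** The gaps just below level [Q k.+1] have length at least [4 * M * del k.+1]. Their middle half
    stays uncut for [M * Q k.+1] further levels, during which [Q k.+1] remains a return time. *)
Lemma frequent_atmost_unbounded (M : nat) : (0 < M)%N ->
  frequent (2^-1) (atmost M%:R^-1).
Proof.
move=> M0 n0; have [k [n0k ak]] := unb (4 * M) n0.+2.
pose n := (Q k.+1).-1.
have Q1 := Q_gt0 theta k; have Qk := Q_ge theta k.
exists n, (n + M * Q k.+1)%N; split; first by rewrite leq_addr andbT /n; lia.
move=> t ht; have [lo [hi g]] := gap_exists theta n t.
have L : del k <= hi - lo by apply: gap_ge g _; rewrite prednK.
have dk := del_rec theta k; have d1 := del_gt0 theta k.+1; have d2 := del_gt0 theta k.+2.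
have M1 : (1 : R) <= M%:R by rewrite ler1n.
have h4 : (4 * M%:R) * del k.+1 <= hi - lo.
  have : (4 * M)%:R * del k.+1 <= (quot theta k)%:R * del k.+1.
    by rewrite ler_wpM2r ?(ltW d1) // ler_nat.
  by rewrite natrM; lra.
exists lo, hi, (lo + M%:R * del k.+1), (hi - M%:R * del k.+1).
have Md : 0 <= M%:R * del k.+1 by rewrite mulr_ge0 // ltW.
split=> //; [lra|lra|lra|].
move=> y yab; have [lo' [hi' g']] := gap_exists theta (n + M * Q k.+1) y.
have L' := long_gap_in_middle g yab g'.
have hy01 : 0 <= y < 1 by apply: (sub_itv01 ht g _ _ yab); lra.
apply: le_trans (tau_le_gap (k := k.+1) hy01 g' _ _) _ => //.
  by move: L'; rewrite mulr2n; nra.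
rewrite lee_fin ler_pdivlMl ?ltr0n // -natrM ler_nat; lia.
Qed.

End Unbounded.

(** * Return times for bounded partial quotients *)

Section Bounded.
Context (A : nat).
Hypothesis quot_le : forall k, (quot theta k <= A)%N.

Lemma Q_le_mul k : (Q k.+2 <= A.+1 * Q k.+1)%N.
Proof. by rewrite QE; have := quot_le k; have := Q_leS theta k; nia. Qed.

Lemma del_le_mul k i : del k <= A.+1%:R ^+ i * del (k + i).
Proof.
elim: i => [|i IH]; first by rewrite addn0 mul1r.
apply: (le_trans IH); rewrite exprSr -mulrA ler_wpM2l ?exprn_ge0 // addnS.
have dk := del_rec theta (k + i); have d1 := del_gt0 theta (k + i).+1.
have d2 := delS_lt theta (k + i).+1.
have := quot_le (k + i); rewrite -(ler_nat R) => h.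
have := ler_wpM2r (ltW d1) h; rewrite -natr1; lra.
Qed.

Local Notation B := (A.+1%:R : R).
Local Lemma B_ge1 : 1 <= B. Proof. by rewrite ler1n. Qed.

Lemma gap_prop n k i t lo hi : gap n t lo hi -> (Q k + Q k.+1 <= n.+1)%N ->
  (B ^+ i)^-1 * (hi - lo) <= del (k + i).
Proof.
move=> g /(gap_le g) L; rewrite ler_pdivrMl ?exprn_gt0 //.
exact: le_trans L (del_le_mul k i).
Qed.

(** One displacement by [del K.+1] cuts off a short gap at level [n + Q K.+1], with return time at
    least [Q K.+1 + Q K]. The excess [Q K - n] is a fixed proportion of the level. *)
Lemma frequent_atleast_bounded :
  frequent (B ^+ 6)^-1 (atleast (1 + (2 * B + 1)^-1)).
Proof.
(* Four steps multiply the denominators by at least 4, so [K = k + 5] ensures [2 * n <= Q K]. *)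
move=> n0; pose k := n0; pose n := (Q k + Q k.+1)%N; pose K := (k + 5)%N.
have Qk := Q_ge theta k; have Q01 := Q_leS theta k; have Q1 := Q_gt0 theta k.
have nK : (2 * n <= Q K)%N.
  by have := Q_grow theta k.+1; rewrite /n /K -[5%N]/(1 + 4)%N addnA addn1; lia.
have K1 := Q_leS theta K; have K2 := Q_leS theta K.+1; have K3 := Q_fib theta K.
have K4 : (Q K.+1 <= A.+1 * Q K)%N by rewrite /K addnS; exact: Q_le_mul.
exists n, (n + 1 * Q K.+1)%N; split; first by rewrite leq_addr andbT /n; lia.
move=> t ht; have [lo [hi g]] := gap_exists theta n t.
have [a [b [la bh ab hy]]] := short_gaps_at_end K.+1 1 g.
exists lo, hi, a, b; split=> //.
  apply: le_trans ab; have L := @gap_prop n k 6 _ _ _ g (leqnSn _).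
  have L' : del K.+1 <= hi - lo by apply: gap_ge g _; lia.
  by rewrite mul1r (min_r L') -/K /K -addnS.
move=> y yab; have [lo' [hi' [g' L']]] := hy y yab.
have hy01 := sub_itv01 ht g la bh yab.
apply: le_trans (tau_ge_gap hy01 g' L').
rewrite lee_fin mul1n; clearbody n.
move: (Q K) (Q K.+1) (Q K.+2) nK K3 K4 => q0 q1 q2 nK K3 K4.
have B1 := B_ge1; move: nK K3 K4; rewrite -!(ler_nat R) !natrD !natrM => nK K3 K4.
rewrite mulrDl mul1r.
have : (2 * B + 1)^-1 * (n%:R + q1%:R) <= q0%:R / 2.
  rewrite ler_pdivrMl; last by lra.
  by move: nK K3 K4 B1; clear; nra.
by move: nK K3; clear; lra.
Qed.

(** Just before level [Q K.+2] every gap of level [n] still has a long gap at one end. Its return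
    time is at most [Q K.+1], smaller than the level by about [Q K]. *)
Lemma frequent_atmost_bounded :
  frequent (B ^+ 5)^-1 (atmost (2 * B / (2 * B + 1))).
Proof.
move=> n0; pose k := n0; pose n := (Q k + Q k.+1)%N; pose K := (k + 4)%N.
have Qk := Q_ge theta k; have Q01 := Q_leS theta k; have Q1 := Q_gt0 theta k.
have nK : (2 * n <= Q K.+1)%N.
  by have := Q_grow theta k.+1; rewrite /n /K addSn; lia.
have K0 : (1 < Q K)%N by have := Q_ge theta (k + 3); rewrite -addnS -/K /K; lia.
have K3 := Q_fib theta K; have K4 : (Q K.+1 <= A.+1 * Q K)%N.
  by rewrite /K addnS; exact: Q_le_mul.
exists n, (Q K.+2).-1; split; first by rewrite /n; lia.
move=> t ht; have [lo [hi g]] := gap_exists theta n t.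
have nK' : (n < Q K.+1)%N by rewrite /n in nK *; lia.
have [a [b [la bh ab hy]]] := long_gap_at_end g nK'.
exists lo, hi, a, b; split=> //.
  have L := @gap_prop n k 5 _ _ _ g (leqnSn _).
  by have := del_gt0 theta K.+2; rewrite ab /K -addnS => d; rewrite (le_trans L) // lerDl ltW.
move=> y yab; have [lo' [hi' [g' L']]] := hy y yab.
have hy01 := sub_itv01 ht g la bh yab.
apply: le_trans (tau_le_gap hy01 g' _ L') _ => //.
rewrite lee_fin mulrAC ler_pdivlMr; last by have := B_ge1; lra.
have : ((Q K.+1 + Q K).-1 <= (Q K.+2).-1)%N by lia.
(* The loss of 1 in the level is absorbed because [Q K >= 2]. *)
have : (Q K + 2 * Q K.+1 <= 2 * (Q K.+1 + Q K).-1)%N by lia.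
move: (Q K.+1) (Q K) ((Q K.+1 + Q K).-1) ((Q K.+2).-1) K4 => q1 q0 w m.
rewrite -!(ler_nat R) !natrD !natrM => h1 h2 h3; have B1 := B_ge1.
by move: B1 h1 h2 h3; clear; nra.
Qed.

(** For [Q k.+2 <= n < Q k.+3] the gap length lies between [del k.+2] and [del k], so the return
    time lies between [Q k.+1] and [Q k.+3], and these denominators are comparable to [n]. *)
Lemma tau_bounded (n : nat) (t : R) : 0 <= t < 1 -> (Q 2 <= n)%N ->
  (((B ^+ 2)^-1 * n%:R)%:E <= tauc n (coding alpha t) <= (B * n%:R)%:E)%E.
Proof.
move=> ht n2; have n1 : (Q 1 <= n)%N by apply: leq_trans n2; exact: Q_leS.
have [[|k] /andP[k1 k2]] := Q_bracket n1; first by lia.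
have [lo [hi g]] := gap_exists theta n t; apply/andP; split.
- have L : hi - lo <= del k by apply: gap_le g _; have := Q_fib theta k; lia.
  apply: le_trans (tau_ge_gap ht g L); rewrite lee_fin ler_pdivrMl ?exprn_gt0 //.
  have := Q_le_mul k; have := Q_le_mul k.+1; rewrite -natrX -natrM ler_nat; nia.
- have L : del k.+2 <= hi - lo by apply: gap_ge g _.
  have L' : del k.+3 < hi - lo by apply: lt_le_trans (delS_lt _ _) L.
  apply: le_trans (tau_le_gap ht g _ L') _ => //.
  by rewrite lee_fin -natrM ler_nat; have := Q_le_mul k.+1; nia.
Qed.

End Bounded.

Lemma quot_bounded : bounded_partial_quotients alpha ->
  exists A, forall k, (quot theta k <= A)%N.
Proof.
move=> [M hM]; exists `|M|%N => k.
by have := hM k; rewrite -quotE; lia.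
Qed.

(** Finitely many early quotients do not affect boundedness, so large ones occur arbitrarily
    late. *)
Lemma quot_unbounded : ~ bounded_partial_quotients alpha ->
  forall A n0, exists k, (n0 <= k)%N /\ (A <= quot theta k)%N.
Proof.
move=> nb A n0; apply: contrapT => h; apply: nb.
exists (maxn A (\max_(i < n0) quot theta i)%N)%:Z => k; rewrite -quotE lez_nat.
case: (ltnP k n0) => kn.
- by apply: leq_trans (leq_maxr _ _); exact: (leq_bigmax (Ordinal kn)).
- apply: leq_trans (leq_maxl _ _); rewrite leqNgt; apply/negP => lt.
  by apply: h; exists k; split=> //; exact: ltnW.
Qed.

End Arcs.

(** * Conditional Borel-Cantelli for Lebesgue measure *)

Lemma measure_fibers (d : measure_display) (T : measurableType d) (R : realType)
    (mu : {measure set T -> \bar R}) (F : finType) (f : T -> F) (A : set T) :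
  (forall w, measurable (A `&` [set x | f x = w])) ->
  mu A = (\sum_(w : F) mu (A `&` [set x | f x = w]))%E.
Proof.
move=> mA; rewrite -big_enum /= fsbig_seq ?enum_uniq // -measure_fin_bigcup //.
- congr (mu _); apply/seteqP; split=> [x Ax|x [w _ []] //].
  by exists (f x) => //=; rewrite mem_enum.
- by move=> i j _ _ [x [[_ /= <-] [_ /= <-]]].
Qed.

Lemma negligible_bigcap_small (d : measure_display) (T : measurableType d) (R : realType)
    (mu : {measure set T -> \bar R}) (B : nat -> set T) :
  (forall N, measurable (B N)) ->
  (forall e : R, 0 < e -> exists N, (mu (B N) <= e%:E)%E) ->
  mu.-negligible (\bigcap_N B N).
Proof.
move=> mB small; have mI : measurable (\bigcap_N B N) by exact: bigcapT_measurable.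
apply/negligibleP => //; apply/eqP; rewrite eq_le measure_ge0 andbT.
apply/lee_addgt0Pr => e e0; rewrite add0e; have [N hN] := small e e0.
apply: le_trans hN; apply: le_measure; rewrite ?inE //.
by move=> x; apply.
Qed.

Lemma ae_negligible (d : measure_display) (T : measurableType d) (R : realType)
    (mu : {measure set T -> \bar R}) (A : set T) (p : T -> Prop) :
  mu.-negligible A -> (forall x, ~ A x -> p x) -> {ae mu, forall x, p x}.
Proof.
move=> [B [mB B0 AB]] h; exists B; split=> // x /= npx.
by apply: AB; apply: contrapT => nA; apply: npx; exact: h.
Qed.

Definition window (z : int) (N : nat) (x : int -> bool) : {ffun 'I_N -> bool} :=
  [ffun i : 'I_N => x (z + i%:Z)].

Lemma windowP z N x y :
  window z N x = window z N y <-> forall i, (i < N)%N -> x (z + i%:Z) = y (z + i%:Z).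
Proof.
split=> [/ffunP h i iN|h]; first by have := h (Ordinal iN); rewrite !ffunE.
by apply/ffunP => i; rewrite !ffunE h.
Qed.

(** Finite unions of cylinders on the coordinates [z, ..., z + N - 1]. *)
Definition local (z : int) (N : nat) (B : set (int -> bool)) : Prop :=
  forall x y, window z N x = window z N y -> B x -> B y.

Section Lebesgue.
Context (R : realType) (theta : angle R).
Local Notation alpha := (angle_val theta).
Local Notation gap := (gap theta).
Local Notation tauc := (tauc theta).
Local Notation leb := (@lebesgue_measure R).

Definition codes (B : set (int -> bool)) : set R :=
  [set t | 0 <= t < 1 /\ B (coding alpha t)].

Lemma cyl_window n (t : R) :
  codes [set x | window 0 n x = window 0 n (coding alpha t)] = cyl theta n (coding alpha t).
Proof.
apply/seteqP; split=> y [y01 h]; split=> //.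
- by move=> i ilt; have /windowP/(_ i ilt) := h; rewrite add0r.
- by apply/windowP => i ilt; rewrite add0r h.
Qed.

Lemma tauc_window n x y : window 0 n x = window 0 n y -> tauc n x = tauc n y.
Proof.
move=> /windowP h; congr tau; apply/seteqP.
by split=> t [t01 ht]; split=> // i ilt; have := h i ilt; rewrite add0r ht // => ->.
Qed.

Lemma codes_window n (w : {ffun 'I_n -> bool}) :
  codes [set x | window 0 n x = w] = set0 \/
  exists t lo hi, [/\ 0 <= t < 1, window 0 n (coding alpha t) = w, gap n t lo hi &
    codes [set x | window 0 n x = w] = `[lo, hi[%classic].
Proof.
have [[t [t01 <-]]|h] := pselect (exists t, codes [set x | window 0 n x = w] t); last first.
  by left; apply/seteqP; split=> // t ht; apply: h; exists t.
right; have [lo [hi g]] := gap_exists theta n t.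
exists t, lo, hi; split=> //; rewrite cyl_window (gap_cyl t01 g).
by apply/seteqP; split=> y /=; rewrite in_itv.
Qed.

Lemma leb_co (lo hi : R) : lo <= hi -> leb `[lo, hi[%classic = (hi - lo)%:E.
Proof.
rewrite lebesgue_measure_itv /= lte_fin le_eqVlt => /orP[/eqP ->|->].
- by rewrite ltxx subrr.
- by rewrite EFinB.
Qed.

Lemma measurable_codes_window n (w : {ffun 'I_n -> bool}) :
  measurable (codes [set x | window 0 n x = w]).
Proof. by case: (codes_window w) => [->|[t [lo [hi [_ _ _ ->]]]]]. Qed.

Lemma local_window z N B x : local z N B -> B x ->
  B `&` [set y | window z N y = window z N x] = [set y | window z N y = window z N x].
Proof.
move=> lB Bx; apply/seteqP; split=> [y []//|y /= hy]; split=> //.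
by apply: lB Bx; rewrite hy.
Qed.

Lemma local_windowE z N B w : local z N B ->
  B `&` [set y | window z N y = w] = [set y | window z N y = w] \/
  B `&` [set y | window z N y = w] = set0.
Proof.
move=> lB; have [[x [Bx <-]]|h] := pselect (exists x, B x /\ window z N x = w).
- by left; exact: local_window.
- by right; apply/seteqP; split=> // y [By /= yw]; apply: h; exists y.
Qed.

Lemma codesI B C : codes (B `&` C) = codes B `&` [set t | C (coding alpha t)].
Proof. by apply/seteqP; split=> [t [? [? ?]]|t [[? ?] ?]]. Qed.

Lemma codes_set0 : codes set0 = set0.
Proof. by apply/seteqP; split=> t []. Qed.

Lemma measurable_codes N B : local 0 N B -> measurable (codes B).
Proof.
move=> lB; have -> : codes B = \bigcup_(w : {ffun 'I_N -> bool})
    codes (B `&` [set x | window 0 N x = w]).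
  apply/seteqP; split=> [t [t01 Bt]|t [w _ [t01 []]]//].
  by exists (window 0 N (coding alpha t)).
apply: fin_bigcup_measurable => // w _.
have [->|->] := local_windowE w lB; first exact: measurable_codes_window.
by rewrite codes_set0.
Qed.

Lemma leb_codes_sum N n B : local 0 N B -> leb (codes B) =
  (\sum_(w : {ffun 'I_n -> bool}) leb (codes (B `&` [set x | window 0%R n x = w])))%E.
Proof.
move=> lB; rewrite (@measure_fibers _ _ _ leb _ (fun t : R => window 0 n (coding alpha t))).
- by apply: eq_bigr => w _; rewrite codesI.
- move=> w; rewrite -(codesI B [set x | window 0 n x = w]).
  apply: (@measurable_codes (maxn N n)) => x y /windowP h [Bx wx]; split.
  + by apply: lB Bx; apply/windowP => i ilt; apply: h; rewrite leq_max ilt.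
  + rewrite /= -wx; apply/windowP => i ilt; symmetry; apply: h.
    by rewrite leq_max ilt orbT.
Qed.

Section Frequent.
Context (c : R) (G : nat -> \bar R -> Prop).
Hypothesis c0 : 0 < c.
Hypothesis fG : frequent theta c G.

(** The event fails at all levels from [n0] to [N]; only the first [N] letters decide this. *)
Definition bad (n0 N : nat) : set (int -> bool) :=
  [set x | forall m, (n0 <= m <= N)%N -> ~ G m (tauc m x)].

Lemma bad_local n0 N : local 0 N (bad n0 N).
Proof.
move=> x y /windowP h bx m /andP[m1 m2].
rewrite -(@tauc_window m x y); first by apply: bx; rewrite m1.
by apply/windowP => i ilt; apply: h; exact: leq_trans m2.
Qed.

Lemma bad_le n0 N N' : (N <= N')%N -> bad n0 N' `<=` bad n0 N.
Proof.
by move=> NN' x bx m /andP[m1 m2]; apply: bx; rewrite m1 (leq_trans m2).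
Qed.

Lemma frequent_le1 : c <= 1.
Proof.
have [n [m [_ /(_ 0)]]] := fG 0; rewrite lexx ltr01 => /(_ isT).
move=> [lo [hi [a [b [g la bh cab _]]]]].
have L : 0 < hi - lo by case: g => /andP[? ?] _ _ _; lra.
by rewrite -(ler_pM2r L) mul1r; lra.
Qed.

(** The set of points still bad at level [n] is a union of gaps of that level. Each of them loses
    its arc, hence a proportion [c], by the later level [m]. *)
Lemma bad_decay n0 N : exists N', (N <= N')%N /\
  (leb (codes (bad n0 N')) <= (1 - c)%:E * leb (codes (bad n0 N)))%E.
Proof.
have c1 := frequent_le1.
have [n [m [/andP[nN nm] h]]] := fG (maxn n0 N).
have n0n : (n0 <= n)%N by apply: leq_trans nN; exact: leq_maxl.
have Nn : (N <= n)%N by apply: leq_trans nN; exact: leq_maxr.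
exists m; split; first exact: leq_trans nm.
apply: (@le_trans _ _ ((1 - c)%:E * leb (codes (bad n0 n)))%E); last first.
  apply: lee_wpmul2l; first by rewrite lee_fin; lra.
  apply: le_measure; rewrite ?inE.
  - exact: measurable_codes (@bad_local _ _).
  - exact: measurable_codes (@bad_local _ _).
  - by move=> t [t01 bt]; split=> //; exact: bad_le bt.
rewrite (leb_codes_sum n (@bad_local n0 m)) (leb_codes_sum n (@bad_local n0 n)).
rewrite ge0_sume_distrr; last by move=> w _; exact: measure_ge0.
apply: lee_sum => w _.
have [[t [t01 [bt tw]]]|ne] := pselect (exists t, codes (bad n0 m `&` [set x | window 0 n x = w]) t);
  last first.
  rewrite (_ : codes (bad n0 m `&` _) = set0) ?measure0; last first.
    by apply/seteqP; split=> // t ht; apply: ne; exists t.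
  by rewrite mule_ge0 ?measure_ge0 // lee_fin; lra.
rewrite /= in tw; rewrite -tw.
have [lo [hi [a [b [g la bh cab hab]]]]] := h t t01.
have L : 0 < hi - lo by case: g => /andP[? ?] _ _ _; lra.
have cL : 0 < c * (hi - lo) by rewrite mulr_gt0.
rewrite (local_window (@bad_local n0 n)); last exact: bad_le bt.
have cE := gap_cyl t01 g.
rewrite cyl_window cE.
have -> : [set y | lo <= y < hi] = `[lo, hi[%classic.
  by apply/seteqP; split=> y /=; rewrite in_itv.
rewrite leb_co; last by lra.
(* Within the gap, only points outside the arc can remain bad at level [m]. *)
have sub : codes (bad n0 m `&` [set x | window 0 n x = window 0 n (coding alpha t)]) `<=`
    `[lo, a[%classic `|` `[b, hi[%classic.
  rewrite codesI => y [[y01 by_] /= wy].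
  have : cyl theta n (coding alpha t) y by rewrite -cyl_window.
  rewrite cE /= !in_itv /= => /andP[y1 y2].
  have [ya|ya] := ltP y a; first by left; rewrite y1.
  have [yb|yb] := ltP y b; last by right; rewrite y2.
  exfalso; apply: (by_ m); last by apply: hab; rewrite ya.
  by rewrite leqnn andbT (leq_trans n0n).
have mB : measurable (codes (bad n0 m `&`
    [set x | window 0 n x = window 0 n (coding alpha t)])).
  apply: (@measurable_codes m) => x y hxy [bx wx]; split; first exact: bad_local hxy bx.
  rewrite /= -wx; apply/windowP => i ilt; move/windowP: hxy => /(_ i) ->//.
  exact: leq_trans nm.
apply: (@le_trans _ _ (leb (`[lo, a[%classic `|` `[b, hi[%classic))).
  by apply: le_measure; rewrite ?inE //; exact: measurableU.
apply: (@le_trans _ _ (leb `[lo, a[%classic + leb `[b, hi[%classic)%E); first exact: measureU2.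
rewrite !leb_co // -EFinD -EFinM lee_fin; lra.
Qed.

Lemma bad_small n0 (e : R) : 0 < e -> exists N, (leb (codes (bad n0 N)) <= e%:E)%E.
Proof.
move=> e0; have c1 := frequent_le1.
have pow i : exists N, (leb (codes (bad n0 N)) <= ((1 - c) ^+ i)%:E)%E.
  elim: i => [|i [N hN]].
    exists 0%N; rewrite expr0; apply: (@le_trans _ _ (leb `[0, 1[%classic)).
      apply: le_measure; rewrite ?inE //; first exact: measurable_codes (@bad_local _ _).
      by move=> t [t01 _]; rewrite /= in_itv.
    by rewrite leb_co // subr0.
  have [N' [_ hN']] := bad_decay n0 N; exists N'; apply: (le_trans hN').
  by rewrite exprS EFinM; apply: lee_wpmul2l => //; rewrite lee_fin; lra.
have : `|1 - c| < 1 by rewrite ger0_norm ?subr_ge0 // ltrBlDr ltrDl.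
move=> /cvg_expr /cvgrPdist_lt /(_ e e0) [i _ /(_ i (leqnn i))].
have [N hN] := pow i; rewrite /= sub0r normrN => hi.
exists N; apply: (le_trans hN); rewrite lee_fin.
exact: le_trans (ler_norm _) (ltW hi).
Qed.

Lemma leb_frequent : {ae leb, forall t : R, 0 <= t < 1 ->
  forall n0 : nat, exists m, (n0 <= m)%N /\ G m (tauc m (coding alpha t))}.
Proof.
apply: (@ae_negligible _ _ _ leb (\bigcup_n0 \bigcap_N codes (bad n0 N))).
  apply: negligible_bigcup => n0; apply: negligible_bigcap_small => [N|].
  - exact: measurable_codes (@bad_local _ _).
  - exact: bad_small.
move=> t nt t01 n0; apply: contrapT => hn0; apply: nt; exists n0 => // N _.
by split=> // m /andP[m1 m2] Gm; apply: hn0; exists m.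
Qed.

End Frequent.
End Lebesgue.

(** * Unique ergodicity *)

Section Counting.
Context (R : realType) (theta : angle R).
Local Notation alpha := (angle_val theta).
Local Notation Q := (cfden theta).
Local Notation P := (cfnum theta).

Definition visits (q : nat) (t a b : R) : {set 'I_q} :=
  [set j : 'I_q | `[< exists z : int, a <= t + j%:R * alpha - z%:~R < b >]]%SET.

(* Denjoy-Koksma: [t + j alpha] is within [1/q] of [t + j p / q], and the
   residues [j p mod q] are a permutation of [0, ..., q - 1]. *)
Lemma visits_ge k (t a b : R) : b - a <= 1 ->
  (Q k.+1)%:R * (b - a) - 3 <= #|visits (Q k.+1) t a b|%:R.
Proof.
move=> ab1; set q := Q k.+1.
have q0 : (0 < q)%N by exact: Q_gt0.
have qR : 0 < q%:R :> R by rewrite ltr0n.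
have q0R : q%:R != 0 :> R by rewrite gt_eqF.
case: (lerP (q%:R * (b - a) - 2) 0) => [h|h]; first by apply: (@le_trans _ _ 0) => //; lra.
(* Keeping a distance [1/q] from both ends costs 2, and truncation costs less than 1. *)
pose K := Num.truncn (q%:R * (b - a) - 2).
have /andP[K1 K2] := truncn_itv (ltW h); rewrite -/K in K1 K2.
suff : (K <= #|visits q t a b|)%N by rewrite -(ler_nat R); lra.
have Kq : (K < q)%N.
  rewrite -(ltr_nat R); have : q%:R * (b - a) <= q%:R * 1 by rewrite ler_wpM2l // ltW.
  by rewrite mulr1; lra.
pose r0 := Num.ceil (q%:R * (a - t) + 1).
have /andP[r1 r2] := ceil_itv (q%:R * (a - t) + 1); rewrite -/r0 intrB in r1 r2.
pose e : int := (-1) ^+ k.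
have ee : e * e = 1 by rewrite /e -expr2 sqrr_sign.
have det := det_continuants theta k; rewrite -/e -/q in det.
(* By the determinant identity [v] is an inverse of [p] modulo [q]; so [f i] below is the time at
   which [j * p] has residue [r i]. *)
pose p : int := (P k.+1)%:Z; pose v : int := - e * (Q k)%:Z.
pose r (i : 'I_K) : int := r0 + i%:Z.
pose z (i : 'I_K) : int := - (e * (P k)%:Z * r i + p * ((v * r i) %/ q)%Z).
have q0' : q%:Z != 0 by rewrite eqz_nat -lt0n.
have mlt (i : 'I_K) : (`|((v * r i) %% q)%Z|%N < q)%N.
  by rewrite -ltz_nat gez0_abs ?modz_ge0 //; have := ltz_mod (v * r i) q0'; lia.
pose f (i : 'I_K) : 'I_q := Ordinal (mlt i).
have fE i : p * (f i)%:Z = r i + q%:Z * z i.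
  rewrite /f /= gez0_abs ?modz_ge0 //.
  have dv := divz_eq (v * r i) q%:Z.
  have -> : ((v * r i) %% q)%Z = v * r i - ((v * r i) %/ q)%Z * q%:Z by rewrite {2}dv; ring.
  apply/eqP; rewrite -subr_eq0 /z; set d := ((v * r i) %/ q)%Z; apply/eqP.
  transitivity ((e * (q%:Z * (P k)%:Z - (Q k)%:Z * (P k.+1)%:Z) - 1) * r i).
    by rewrite /v /p; ring.
  by rewrite det ee subrr mul0r.
have finj : injective f.
  move=> i i' ff; have := fE i; rewrite ff fE /r => eq.
  have h1 := ltn_ord i; have h2 := ltn_ord i'; apply/val_inj.
  have : (i%:Z - i'%:Z) = q%:Z * (z i' - z i) by lia.
  move: (z i' - z i) => w; case: (ltrgtP w 0) => w0 hw; [nia|nia|].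
  by move: hw; rewrite w0 mulr0 /=; lia.
clearbody f z.
rewrite -[leqLHS](card_ord K) -(card_imset _ finj); apply: subset_leq_card.
apply/fintype.subsetP => j /imsetP[i _ ->]; rewrite inE; apply/asboolP; exists (z i).
have -> : (f i)%:R * alpha = (p%:~R * (f i)%:R + (f i)%:R * (q%:R * alpha - p%:~R)) / q%:R.
  by rewrite -[LHS](mulfK q0R); congr (_ / _); ring.
have := fE i; move/(congr1 (fun u : int => u%:~R : R)).
rewrite intrM intrD intrM -!pmulrn => ->.
(* The error is less than [q * del k.+1], and [del k.+1 <= 1 / Q k.+2]. *)
have bnd : `|(f i)%:R * (q%:R * alpha - p%:~R)| <= 1.
  rewrite normrM normr_nat -pmulrn approx_sign normrM normrX normrN1 expr1n mul1r.
  rewrite gtr0_norm ?del_gt0 //; apply: (@le_trans _ _ (q%:R * (Q k.+2)%:R^-1)).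
    by apply: ler_pM; rewrite ?ler_nat ?(ltW (del_gt0 _ _)) ?del_le_inv // ltnW.
  by rewrite ler_pdivrMr ?ltr0n ?Q_gt0 // mul1r ler_nat Q_leS.
move: bnd; rewrite ler_norml; set d := (f i)%:R * _ => /andP[d1 d2].
have hi : (i%:R : R) <= K%:R - 1 by rewrite lerBrDr natr1 ler_nat.
have hi0 : (0 : R) <= i%:R by [].
have rE : (r i)%:~R = r0%:~R + i%:R :> R by rewrite intrD -pmulrn.
have -> : t + ((r i)%:~R + q%:R * (z i)%:~R + d) / q%:R - (z i)%:~R =
    (q%:R * t + (r i)%:~R + d) / q%:R by field.
rewrite ler_pdivlMr // ltr_pdivrMr // rE; apply/andP; split; nra.
Qed.

End Counting.

(** * Measurability of cylinder events and shifts of codings *)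

Lemma measurable_window z N (w : {ffun 'I_N -> bool}) :
  measurable ([set x | window z N x = w] : set seqZ).
Proof.
have -> : [set x : seqZ | window z N x = w] =
    \bigcap_(i in [set: 'I_N]) [set x : seqZ | x (z + i%:Z) = w i].
  apply/seteqP; split=> [x /= <- i _ /=|x h]; first by rewrite ffunE.
  by apply/ffunP => i; rewrite ffunE; exact: h.
apply: fin_bigcap_measurable => // i _.
by apply: sub_sigma_algebra; exists (z + i%:Z), (w i).
Qed.

Lemma measurable_local z N (B : set seqZ) : local z N B -> measurable B.
Proof.
move=> lB; have -> : B = \bigcup_(w : {ffun 'I_N -> bool}) (B `&` [set x | window z N x = w]).
  by apply/seteqP; split=> [x Bx|x [w _ []]//]; exists (window z N x).
apply: fin_bigcup_measurable => // w _.
have [->|->] := local_windowE w lB; first exact: measurable_window.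
exact: measurable0.
Qed.

(** Each condition in the countable intersection concerns only the [2 * N + 1] coordinates from [-N]
    to [N]. *)
Lemma measurable_Omega (R : realType) (alpha : R) : measurable (Omega alpha : set seqZ).
Proof.
have -> : (Omega alpha : set seqZ) = \bigcap_N [set x : seqZ | exists2 t : R, 0 <= t < 1 &
    forall n : int, - N%:Z <= n <= N%:Z -> coding alpha t n = x n].
  by apply/seteqP; split=> [x h N _|x h N]; apply: h.
apply: bigcapT_measurable => N; apply: (@measurable_local (- N%:Z) (N + N).+1).
move=> x y /windowP h [t t01 tx]; exists t => // n /andP[n1 n2].
rewrite tx ?n1 //; have := h `|(n + N%:Z)%R|%N ltac:(lia).
by have -> : - N%:Z + `|(n + N%:Z)%R|%N%:Z = n by lia.
Qed.

Lemma coding_Omega (R : realType) (alpha t : R) : 0 <= t < 1 -> Omega alpha (coding alpha t).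
Proof. by move=> t01 N; exists t. Qed.

Lemma fracpartDz (R : realType) (x : R) (z : int) : fracpart (x + z%:~R) = fracpart x.
Proof.
apply: (@fracpart_uniq _ _ _ (Num.floor x + z)); first exact: fracpart_itv.
by rewrite /fracpart intrD; ring.
Qed.

Lemma coding_shift (R : realType) (alpha t : R) (j i z : int) :
  coding alpha (t + j%:~R * alpha - z%:~R) i = coding alpha t (j + i).
Proof.
rewrite /coding; congr Ialpha; rewrite -[RHS](fracpartDz _ (- z)) intrN intrD.
by congr fracpart; ring.
Qed.

Section UniqueErgodicity.
Context (R : realType) (theta : angle R) (mu : probability seqZ R).
Local Notation alpha := (angle_val theta).
Local Notation Q := (cfden theta).
Local Notation leb := (@lebesgue_measure R).
Hypothesis mu_supp : mu (Omega alpha) = 1%E.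
Hypothesis mu_inv : forall A : set seqZ, measurable A ->
  mu (@preimage seqZ seqZ Sshift A) = mu A.

Lemma mu_window (j N : nat) (w : {ffun 'I_N -> bool}) :
  mu [set x | window j%:Z N x = w] = mu [set x | window 0 N x = w].
Proof.
elim: j => [//|j IH]; rewrite -IH -[RHS]mu_inv; last exact: measurable_window.
congr (mu _); apply/seteqP; split=> x /= <-; apply/ffunP => i;
  rewrite !ffunE /Sshift; congr x; lia.
Qed.

(** On a window of radius [Q k + N] the sequence [x] is a coding, so the counting of visits applies
    to the occurrences of a word in it. *)
Lemma visits_window N (t0 lo hi : R) k (x : seqZ) : 0 <= t0 < 1 -> gap theta N t0 lo hi ->
  Omega alpha x ->
  (Q k)%:R * (hi - lo) - 3 <=
    (\sum_(j < Q k) \1_[set x : seqZ | window (nat_of_ord j)%:Z N x = window 0 N (coding alpha t0)] x : R).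
Proof.
move=> t01 g Ox; case: k => [|k]; first by rewrite big_ord0 mul0r; lra.
have [lo0 hi1] := gap_itv t01 g.
have [t _ tx] := Ox (Q k.+1 + N)%N.
have ab1 : hi - lo <= 1 by lra.
apply: (le_trans (visits_ge theta k t ab1)).
rewrite -sum1_card natr_sum big_mkcond /=; apply: ler_sum => j _.
rewrite indicE; case: ifP => //; rewrite inE => /asboolP[z hz].
rewrite mem_set //=; apply/ffunP => i; rewrite !ffunE.
have jq := ltn_ord j; have iN := ltn_ord i.
rewrite -tx; last by lia.
rewrite -(coding_shift _ _ _ _ z) -pmulrn add0r.
have : cyl theta N (coding alpha t0) (t + j%:R * alpha - z%:~R) by rewrite (gap_cyl t01 g).
by case=> _ /(_ i iN).
Qed.

(** Integrating the count of occurrences over [Omega], with invariance, bounds [Q k] times the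
    measure below by [Q k * (hi - lo) - 3]; letting [k] grow removes the constant. *)
Lemma mu_window_ge N (w : {ffun 'I_N -> bool}) :
  (leb (codes theta [set x | window 0%R N x = w]) <= mu [set x | window 0%R N x = w])%E.
Proof.
have [->|[t0 [lo [hi [t01 <- g ->]]]]] := codes_window theta w.
  by rewrite measure0 measure_ge0.
have L : lo < hi by case: g => /andP[? ?] _ _ _; lra.
rewrite leb_co; last exact: ltW.
set A := [set x | _]; have mA : measurable (A : set seqZ) by exact: measurable_window.
have fA : mu A \is a fin_num by apply: fin_num_measure.
rewrite -(fineK fA) lee_fin; set m := fine (mu A).
have key k : (Q k)%:R * (hi - lo) - 3 <= (Q k)%:R * m.
  pose E (j : 'I_(Q k)) : set seqZ :=
    [set x | window (nat_of_ord j)%:Z N x = window 0 N (coding alpha t0)].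
  have mE j : measurable (E j) by exact: measurable_window.
  have mO : measurable (Omega alpha : set seqZ) := measurable_Omega alpha.
  (* The comparison of integrals below is for nonnegative functions, so a negative bound is treated
     apart. *)
  case: (lerP 0 ((Q k)%:R * (hi - lo) - 3)) => c0; last first.
    by apply: ltW; apply: (lt_le_trans c0); rewrite mulr_ge0 // fine_ge0.
  rewrite -lee_fin.
  have -> : ((Q k)%:R * m)%:E = (\sum_(j < Q k) mu (E j))%E.
    rewrite (eq_bigr (fun=> m%:E)) ?sumEFin ?sumr_const ?card_ord ?mulr_natl //.
    by move=> j _; rewrite /m fineK // /E mu_window.
  apply: (@le_trans _ _ (\sum_(j < Q k) mu (E j `&` Omega alpha))%E); last first.
    by apply: lee_sum => j _; apply: le_measure; rewrite ?inE //; exact: measurableI.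
  rewrite -[leLHS]mule1 -mu_supp -integral_cst //.
  have -> : (\sum_(j < Q k) mu (E j `&` Omega alpha))%E =
      (\sum_(j < Q k) \int[mu]_(x in Omega alpha) (\1_(E j) x)%:E)%E.
    by apply: eq_bigr => j _; rewrite integral_indic.
  rewrite -ge0_integral_sum //; last first.
    by move=> j; apply/measurable_EFinP; exact: measurable_indic.
  apply: ge0_le_integral => //.
  - apply: emeasurable_sum => j; apply/measurable_EFinP; exact: measurable_indic.
  - by move=> x Ox; rewrite sumEFin lee_fin; exact: visits_window.
rewrite leNgt; apply/negP => lt.
have [n hn] : exists n : nat, 3 / (hi - lo - m) < n%:R.
  by exists (Num.truncn (3 / (hi - lo - m))).+1; rewrite truncnS_gt.
have := key n.+1; have := Q_ge theta n; rewrite -(ler_nat R) => h1 h2.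
rewrite ltr_pdivrMr ?subr_gt0 // in hn.
have := ler_wpM2r (_ : 0 <= hi - lo - m) h1; rewrite subr_ge0 => /(_ (ltW lt)).
by lra.
Qed.

(** Both families of masses sum to 1 over all words, so the termwise inequality is an equality. *)
Lemma mu_windowE N (w : {ffun 'I_N -> bool}) :
  mu [set x | window 0%R N x = w] = leb (codes theta [set x | window 0%R N x = w]).
Proof.
pose m (w : {ffun 'I_N -> bool}) := fine (mu [set x | window 0%R N x = w]).
pose l (w : {ffun 'I_N -> bool}) := fine (leb (codes theta [set x | window 0%R N x = w])).
have mw v : mu [set x | window 0%R N x = v] = (m v)%:E.
  by rewrite fineK // fin_num_measure //; exact: measurable_window.
have lw v : leb (codes theta [set x | window 0%R N x = v]) = (l v)%:E.
  rewrite fineK // ge0_fin_numE ?measure_ge0 //.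
  by apply: le_lt_trans (mu_window_ge v) _; rewrite mw ltry.
have lm v : l v <= m v by rewrite -lee_fin -mw -lw mu_window_ge.
have loc : local 0 N setT by [].
have sm : \sum_v m v = 1.
  apply: EFin_inj; rewrite -sumEFin -(probability_setT mu).
  rewrite (@measure_fibers _ _ _ mu _ (fun x : seqZ => window 0 N x)).
    by apply: eq_bigr => v _; rewrite setTI; exact/esym/mw.
  by move=> v; rewrite setTI; exact: measurable_window.
have sl : \sum_v l v = 1.
  apply: EFin_inj; rewrite -sumEFin; transitivity (leb (codes theta setT)).
    by rewrite (leb_codes_sum theta N loc); apply: eq_bigr => v _; rewrite setTI lw.
  have -> : codes theta setT = `[0, 1[%classic.
    by apply/seteqP; split=> t /=; rewrite in_itv /=; [case|].
  by rewrite leb_co // subr0.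
have : \sum_v (m v - l v) == 0 by rewrite sumrB sm sl subrr.
rewrite psumr_eq0; last by move=> v _; rewrite subr_ge0.
move=> /allP /(_ w (mem_index_enum w)) /=; rewrite subr_eq0 => /eqP e.
by rewrite mw lw e.
Qed.

Lemma mu_local N (B : set seqZ) : local 0 N B -> mu B = leb (codes theta B).
Proof.
move=> lB; rewrite (leb_codes_sum theta N lB).
have hB w : (B `&` [set x | window 0 N x = w] = [set x | window 0 N x = w]) \/
   (B `&` [set x | window 0 N x = w] = set0) := local_windowE w lB.
rewrite (@measure_fibers _ _ _ mu _ (fun x : seqZ => window 0 N x)); last first.
  move=> w; have [->|->] := hB w; [exact: measurable_window|exact: measurable0].
apply: eq_bigr => w _; have [->|->] := hB w; first exact: mu_windowE.
by rewrite codes_set0 !measure0.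
Qed.

(** The bad sets are local, so their [mu]-measures are the Lebesgue measures already shown to be
    small. *)
Lemma mu_frequent (c : R) (G : nat -> \bar R -> Prop) : 0 < c -> frequent theta c G ->
  {ae mu, forall x : seqZ, forall n0 : nat, exists m,
    (n0 <= m)%N /\ G m (tauc theta m x)}.
Proof.
move=> c0 fG.
apply: (@ae_negligible _ _ _ mu (\bigcup_n0 \bigcap_N (bad theta G n0 N : set seqZ))).
  apply: negligible_bigcup => n0; apply: negligible_bigcap_small => [N|e e0].
  - exact: measurable_local (@bad_local _ theta G n0 N).
  - have [N hN] := bad_small c0 fG n0 e0; exists N.
    by apply: le_trans hN; rewrite le_eqVlt; apply/orP; left; apply/eqP;
      exact: mu_local (@bad_local _ theta G n0 N).
move=> x nx n0; apply: contrapT => hn0; apply: nx; exists n0 => // N _ m /andP[m1 m2] Gm.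
by apply: hn0; exists m.
Qed.

End UniqueErgodicity.

(** * The dichotomy *)

Section Limits.
Context (R : realType).
Implicit Types (u : nat -> \bar R) (c : \bar R).
Local Open Scope ereal_scope.

Lemma limn_esup_ge u c : (forall n0, exists n, (n0 <= n)%N /\ c <= u n) ->
  c <= limn_esup u.
Proof.
move=> h; apply: le_ereal_inf_tmp => _ [V [N _ NV] <-].
have [n [Nn cu]] := h N; apply: le_trans cu _; apply: ereal_sup_ubound.
by exists n => //; exact: NV.
Qed.

Lemma limn_esup_le u c n0 : (forall n, (n0 <= n)%N -> u n <= c) -> limn_esup u <= c.
Proof.
move=> h; apply: ge_ereal_inf.
exists (ereal_sup [set u x | x in [set n | (n0 <= n)%N]]).
  by exists [set n | (n0 <= n)%N] => //; exists n0.
by apply: ge_ereal_sup => _ [n n0n <-]; exact: h.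
Qed.

Lemma limn_einf_le u c : (forall n0, exists n, (n0 <= n)%N /\ u n <= c) ->
  limn_einf u <= c.
Proof.
move=> h; rewrite /limn_einf leeNl; apply: limn_esup_ge => n0.
by have [n [n0n uc]] := h n0; exists n; split=> //; rewrite leeN2.
Qed.

Lemma limn_einf_ge u c n0 : (forall n, (n0 <= n)%N -> c <= u n) -> c <= limn_einf u.
Proof.
move=> h; rewrite /limn_einf leeNr; apply: (@limn_esup_le _ _ n0) => n n0n.
by rewrite leeN2 h.
Qed.

End Limits.

Section AlmostEverywhere.
Context (d : measure_display) (T : measurableType d) (R : realType).
Context (mu : {measure set T -> \bar R}).

Lemma ae_all (p : T -> Prop) : (forall x, p x) -> {ae mu, forall x, p x}.
Proof.
by move=> h; apply: (@ae_negligible _ _ _ mu set0) => //; exact: negligible_set0.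
Qed.

Lemma ae_and (p q : T -> Prop) : {ae mu, forall x, p x} -> {ae mu, forall x, q x} ->
  {ae mu, forall x, p x /\ q x}.
Proof.
move=> hp hq; apply: (@ae_negligible _ _ _ mu (~` [set x | p x] `|` ~` [set x | q x])).
  exact: negligibleU.
by move=> x nx; split; apply: contrapT => h; apply: nx; [left|right].
Qed.

Lemma ae_forall (p : nat -> T -> Prop) : (forall n, {ae mu, forall x, p n x}) ->
  {ae mu, forall x, forall n, p n x}.
Proof.
move=> hp; apply: (@ae_negligible _ _ _ mu (\bigcup_n ~` [set x | p n x])).
  by apply: negligible_bigcup => n; exact: hp.
by move=> x nx n; apply: contrapT => h; apply: nx; exists n.
Qed.

Lemma ae_imply (p q : T -> Prop) : (forall x, p x -> q x) ->
  {ae mu, forall x, p x} -> {ae mu, forall x, q x}.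
Proof.
move=> pq hp; apply: (@ae_negligible _ _ _ mu (~` [set x | p x])); first exact: hp.
by move=> x /contrapT /pq.
Qed.

Lemma ae_exists (D : set T) (p : T -> Prop) : measurable D -> (mu D != 0)%E ->
  {ae mu, forall x, p x} -> exists x, D x /\ p x.
Proof.
move=> mD D0 [B [mB B0 h]]; apply: contrapT => ne; move/eqP: D0; apply.
apply/eqP; rewrite eq_le measure_ge0 andbT -B0; apply: le_measure; rewrite ?inE //.
by move=> x Dx; apply: h => /= px; apply: ne; exists x.
Qed.

End AlmostEverywhere.

Section Dichotomy.
Context (R : realType) (theta : angle R).
Local Notation alpha := (angle_val theta).
Local Notation Q := (cfden theta).
Local Notation tauc := (tauc theta).

Definition ratioc (x : int -> bool) (n : nat) : \bar R :=
  (tauc n x * ((n%:R)%:E)^-1)%E.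

Lemma ratioc_ge x n r : (0 < n)%N -> atleast r n (tauc n x) -> (r%:E <= ratioc x n)%E.
Proof.
move=> n0; have nR : 0 < n%:R :> R by rewrite ltr0n.
by rewrite /atleast /ratioc inver gt_eqF // lee_pdivlMr.
Qed.

Lemma ratioc_le x n r : (0 < n)%N -> atmost r n (tauc n x) -> (ratioc x n <= r%:E)%E.
Proof.
move=> n0; have nR : 0 < n%:R :> R by rewrite ltr0n.
by rewrite /atmost /ratioc inver gt_eqF // lee_pdivrMr.
Qed.

(** A common frame for both systems: points of [D] are named by sequences of [Omega], by themselves
    in the subshift and by their codings in the rotation. The hypothesis [io] is the Borel-Cantelli
    conclusion. *)
Context (d : measure_display) (T : measurableType d) (mu : {measure set T -> \bar R}).
Context (D : set T) (name : T -> int -> bool) (low upp : T -> \bar R).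
Hypotheses (mD : measurable D) (D0 : (mu D != 0)%E).
Hypothesis nameO : forall x, D x -> Omega alpha (name x).
Hypothesis lowE : forall x, D x -> low x = limn_einf (ratioc (name x)).
Hypothesis uppE : forall x, D x -> upp x = limn_esup (ratioc (name x)).
Hypothesis io : forall c G, 0 < c -> frequent theta c G ->
  {ae mu, forall x, D x -> forall n0 : nat, exists m, (n0 <= m)%N /\ G m (tauc m (name x))}.

Lemma upp_ge_ae c r : 0 < c -> frequent theta c (atleast r) ->
  {ae mu, forall x, D x -> (r%:E <= upp x)%E}.
Proof.
move=> c0 /(io c0); apply: ae_imply => x h Dx; rewrite uppE //.
apply: limn_esup_ge => n0; have [m [m1 m2]] := h Dx n0.+1.
by exists m; split; [exact: ltnW|apply: ratioc_ge m2; exact: leq_ltn_trans m1].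
Qed.

Lemma low_le_ae c r : 0 < c -> frequent theta c (atmost r) ->
  {ae mu, forall x, D x -> (low x <= r%:E)%E}.
Proof.
move=> c0 /(io c0); apply: ae_imply => x h Dx; rewrite lowE //.
apply: limn_einf_le => n0; have [m [m1 m2]] := h Dx n0.+1.
by exists m; split; [exact: ltnW|apply: ratioc_le m2; exact: leq_ltn_trans m1].
Qed.

(** Valid at every point of [D]: the first [n] letters of a name are those of some coding, and
    [tauc n] depends on nothing else. *)
Lemma bounded_rates x : bounded_partial_quotients alpha -> D x ->
  (0 < low x)%E /\ (upp x < +oo)%E.
Proof.
move=> /quot_bounded[A hA] Dx.
have key n : (Q 2 <= n)%N ->
    atleast ((A.+1%:R ^+ 2)^-1) n (tauc n (name x)) /\ atmost A.+1%:R n (tauc n (name x)).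
  move=> n2; have [t t01 tx] := nameO Dx n.
  rewrite -(@tauc_window _ theta n (coding alpha t)); last first.
    by apply/windowP => i ilt; rewrite add0r tx //; lia.
  by have /andP[] := tau_bounded hA t01 n2.
have Q2 := Q_gt0 theta 1.
rewrite lowE // uppE //; split.
- apply: (@lt_le_trans _ _ ((A.+1%:R ^+ 2)^-1)%:E).
    by rewrite lte_fin invr_gt0 exprn_gt0.
  apply: (@limn_einf_ge _ _ _ (Q 2)) => n n2; apply: ratioc_ge; first exact: leq_trans n2.
  by have [] := key n n2.
- apply: (@le_lt_trans _ _ (A.+1%:R)%:E); last by rewrite ltry.
  apply: (@limn_esup_le _ _ _ (Q 2)) => n n2; apply: ratioc_le; first exact: leq_trans n2.
  by have [] := key n n2.
Qed.

(** For unbounded quotients the lower rate is almost surely at most [1 / M] for every [M]. As [D] is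
    not null, some point would have a rate both positive and at most 0. *)
Lemma bounded_iff_low : bounded_partial_quotients alpha <->
  {ae mu, forall x, D x -> (0 < low x)%E}.
Proof.
split=> [b|h]; first by apply: ae_all => x Dx; have [] := bounded_rates b Dx.
apply: contrapT => /quot_unbounded unb.
have small M : {ae mu, forall x, D x -> (low x <= (M.+1%:R^-1)%:E)%E}.
  by apply: (@low_le_ae 2^-1); rewrite ?invr_gt0 //; exact: frequent_atmost_unbounded.
have [x [Dx [/(_ Dx) l0 l1]]] := ae_exists mD D0 (ae_and h (ae_forall small)).
have : (low x <= 0)%E.
  apply/lee_addgt0Pr => e e0; rewrite add0e; apply: le_trans (l1 (Num.truncn e^-1) Dx) _.
  rewrite lee_fin -[leRHS]invrK lef_pV2 ?posrE ?invr_gt0 //; apply: ltW.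
  exact: truncnS_gt.
by rewrite leNgt l0.
Qed.

Lemma bounded_iff_upp : bounded_partial_quotients alpha <->
  {ae mu, forall x, D x -> (upp x < +oo)%E}.
Proof.
split=> [b|h]; first by apply: ae_all => x Dx; have [] := bounded_rates b Dx.
apply: contrapT => /quot_unbounded unb.
have large M : {ae mu, forall x, D x -> (M.+1%:R%:E <= upp x)%E}.
  apply: (@upp_ge_ae ((8 * M.+1)%:R^-1)); first by rewrite invr_gt0 ltr0n.
  exact: frequent_atleast_unbounded.
have [x [Dx [/(_ Dx) u0 u1]]] := ae_exists mD D0 (ae_and h (ae_forall large)).
have ux : upp x \is a fin_num.
  by rewrite fin_numElt u0 andbT (lt_le_trans _ (u1 0%N Dx)) // ltNyr.
have := u1 (Num.truncn (fine (upp x))) Dx; rewrite -[leRHS]fineK // lee_fin leNgt.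
by rewrite truncnS_gt.
Qed.

Lemma bounded_strict : bounded_partial_quotients alpha ->
  {ae mu, forall x, D x -> (low x < 1)%E /\ (1 < upp x)%E}.
Proof.
move=> /quot_bounded[A hA]; have B0 : (0 : R) < A.+1%:R by rewrite ltr0n.
have c0 i : (0 : R) < (A.+1%:R ^+ i)^-1 by rewrite invr_gt0 exprn_gt0.
have := ae_and (low_le_ae (c0 5%N) (frequent_atmost_bounded hA))
               (upp_ge_ae (c0 6%N) (frequent_atleast_bounded hA)).
apply: ae_imply => x [h1 h2] Dx; split.
- apply: le_lt_trans (h1 Dx) _; rewrite lte_fin ltr_pdivrMr; lra.
- apply: lt_le_trans (h2 Dx); rewrite lte_fin ltrDl invr_gt0; lra.
Qed.

End Dichotomy.

(** * Return times in the subshift and conclusion *)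

Lemma iter_Sshift k (x : int -> bool) n : iter k Sshift x n = x (n + k%:Z).
Proof.
elim: k n => [|k IH] n /=; first by rewrite addr0.
by rewrite /Sshift IH; congr x; lia.
Qed.

(* The words of [Omega] are those of the codings, so the first return times of
   corresponding cylinders agree. *)
Lemma tau_Omega (R : realType) (theta : angle R) n x : Omega theta x ->
  tau Sshift (atom (Omega theta) Sshift (fun x : int -> bool => x 0) n x) = tauc theta n x.
Proof.
move=> Ox; rewrite /tauc /tau; congr (ereal_inf (image _ _)).
apply/seteqP; split=> k /= [k1].
(* The radius [n + k] is large enough for one coding to reproduce both occurrences of the word in
   [y]. *)
- move=> [y [Oy h1] [_ h2]]; split=> //; have [t t01 ty] := Oy (n + k)%N.
  have c1 i : (i < n)%N -> coding theta t i%:Z = x i%:Z.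
    move=> ilt; rewrite ty; last by lia.
    by have := h1 i ilt; rewrite !iter_Sshift !add0r.
  exists t; first by split.
  rewrite iter_Rrot //; split=> [|i ilt]; first exact: fracpart_itv.
  rewrite /fracpart (coding_shift (theta : R) t k%:Z) ty; last by lia.
  have := h2 i ilt; rewrite !iter_Sshift !add0r => <-; congr y; lia.
- move=> [t [t01 h1] [t01' h2]]; split=> //.
  exists (coding theta t); first split=> [|i ilt]; first exact: coding_Omega.
    by rewrite !iter_Sshift !add0r h1.
  split=> [|i ilt]; first move=> N.
    exists (iter k (Rrot theta) t) => // m _.
    by rewrite iter_Rrot // iter_Sshift /fracpart (coding_shift (theta : R) t k%:Z) addrC.
  rewrite !iter_Sshift !add0r -(h2 i ilt) iter_Rrot //.
  by rewrite /fracpart (coding_shift (theta : R) t k%:Z) addrC.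
Qed.

Local Open Scope ereal_scope.

Theorem theorem1p3 (R : realType) (alpha : R)
  (halpha : (0 < alpha < 1)%R) (hirr : irrational alpha)
  (mu : probability seqZ R)
  (hsupp : mu (Omega alpha) = 1)
  (hinv : forall A : set seqZ, measurable A -> mu (@preimage seqZ seqZ Sshift A) = mu A) :
  let D := Omega alpha in
  let c := fun x : int -> bool => x 0%R in
  let Dr := [set t : R | (0 <= t < 1)%R] in
  let cr := Ialpha alpha in
  (* (1) *)
  ((bounded_partial_quotients alpha <->
      {ae mu, forall x : seqZ, D x -> 0 < lower_rec (R:=R) D Sshift c x}) /\
   (bounded_partial_quotients alpha <->
      {ae mu, forall x : seqZ, D x -> upper_rec (R:=R) D Sshift c x < +oo})) /\
  (* (2) *)
  (bounded_partial_quotients alpha ->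
      {ae mu, forall x : seqZ, D x ->
         lower_rec (R:=R) D Sshift c x < 1 /\ 1 < upper_rec (R:=R) D Sshift c x}) /\
  (* (3) : (1) and (2) for the rotation with Lebesgue measure *)
  (((bounded_partial_quotients alpha <->
      {ae (@lebesgue_measure R), forall t : R, Dr t ->
          0 < lower_rec (R:=R) Dr (Rrot alpha) cr t}) /\
    (bounded_partial_quotients alpha <->
      {ae (@lebesgue_measure R), forall t : R, Dr t ->
          upper_rec (R:=R) Dr (Rrot alpha) cr t < +oo})) /\
   (bounded_partial_quotients alpha ->
      {ae (@lebesgue_measure R), forall t : R, Dr t ->
         lower_rec (R:=R) Dr (Rrot alpha) cr t < 1 /\
         1 < upper_rec (R:=R) Dr (Rrot alpha) cr t})).
Proof.
move=> D c Dr cr; pose theta := Angle halpha hirr.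
have ratioS (x : seqZ) : D x -> ratio_seq D Sshift c x = ratioc theta x.
  by move=> Dx; apply/funext => n; rewrite /ratio_seq /ratioc -(tau_Omega (theta := theta)).
have ratioR (t : R) : Dr t -> ratio_seq Dr (Rrot alpha) cr t = ratioc theta (coding alpha t).
  by move=> Dt; apply/funext => n; rewrite /ratio_seq (atom_cyl theta).
have mD : measurable (D : set seqZ) := measurable_Omega alpha.
have D0 : mu D != 0 by rewrite hsupp oner_neq0.
have lowS (x : seqZ) : D x -> lower_rec D Sshift c x = limn_einf (ratioc theta x).
  by move=> Dx; rewrite /lower_rec ratioS.
have uppS (x : seqZ) : D x -> upper_rec D Sshift c x = limn_esup (ratioc theta x).
  by move=> Dx; rewrite /upper_rec ratioS.
have ioS (e : R) G : (0 < e)%R -> frequent theta e G ->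
    {ae mu, forall x : seqZ, D x -> forall n0, exists m, (n0 <= m)%N /\ G m (tauc theta m x)}.
  by move=> e0 fG; apply: ae_imply (mu_frequent (theta := theta) hsupp hinv e0 fG) => x h _.
have DrE : Dr = `[0%R, 1%R[%classic by apply/seteqP; split=> t; rewrite /= in_itv.
have mDr : measurable (Dr : set (measurableTypeR R)) by rewrite DrE.
have Dr0 : @lebesgue_measure R Dr != 0 by rewrite DrE leb_co // subr0 oner_neq0.
have lowR (t : R) : Dr t ->
    lower_rec Dr (Rrot alpha) cr t = limn_einf (ratioc theta (coding alpha t)).
  by move=> Dt; rewrite /lower_rec ratioR.
have uppR (t : R) : Dr t ->
    upper_rec Dr (Rrot alpha) cr t = limn_esup (ratioc theta (coding alpha t)).
  by move=> Dt; rewrite /upper_rec ratioR.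
have OR (t : R) : Dr t -> Omega theta (coding alpha t) by exact: coding_Omega.
have ioR (e : R) G : (0 < e)%R -> frequent theta e G ->
    {ae (@lebesgue_measure R), forall t : R, Dr t -> forall n0, exists m,
      (n0 <= m)%N /\ G m (tauc theta m (coding alpha t))}.
  exact: leb_frequent.
split; first split.
- exact: (bounded_iff_low (theta := theta) mD D0 (fun x h => h) lowS uppS ioS).
- exact: (bounded_iff_upp (theta := theta) mD D0 (fun x h => h) lowS uppS ioS).
split; last split; first exact: (bounded_strict (theta := theta) lowS uppS ioS).
- split.
  + exact: (bounded_iff_low (theta := theta) mDr Dr0 OR lowR uppR ioR).
  + exact: (bounded_iff_upp (theta := theta) mDr Dr0 OR lowR uppR ioR).
- exact: (bounded_strict (theta := theta) (mu := @lebesgue_measure R) lowR uppR ioR).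
Qed.
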